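(* Let $M(m,n,r,(\phi_i)_i)$ be a generalized local model and let $U=U((t_i)_i)\subseteq M(m,n,r,(\phi_i)_i)$ be the open subset attached to a family $(t_i)_{i}$ satisfying the admissibility conditions (1), (2) given in the context. Put $$s=\#\{\iota\in\{1,\dots,n\};\ t_i(\iota)=0\text{ for all }i\},\qquad t=\#\{\iota\in\{1,\dots,n\};\ t_i(\iota)=1\text{ for all }i\}.$$ Then $$U\cong W\times\mathbb{A}_O^{rs+t(n-r-s)},$$ where $$W=\Big\{(X_i)_i\in\prod_{i=0}^{m-1}\mathfrak{X}_i;\ X_{m-1}X_{m-2}\cdots X_0=X_{m-2}\cdots X_0X_{m-1}=\cdots=X_0X_{m-1}\cdots X_1=\pi\Big\}$$ (all $m$ cyclic products equal $\pi$ times the identity matrix), and where the $\mathfrak{X}_i$ are the affine subspaces of the space $\operatorname{Mat}_{n-r-s}(O)$ of $(n-r-s)\times(n-r-s)$-matrices described in the context.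
   Context: Let $O$ be a complete discrete valuation ring with perfect residue field and uniformizer $\pi$. Schemes of compatible subspaces. Let $m,n>0$, $0<r<n$, and let $\Lambda_i$, $i=0,\dots,m-1$, be free $O$-modules of rank $n$ with fixed bases $e^i_1,\dots,e^i_n$; indices $i$ are read modulo $m$ ($\Lambda_m:=\Lambda_0$, etc.). Given $O$-linear maps $\phi_i:\Lambda_i\to\Lambda_{i+1}$, let $M(m,n,r,(\phi_i)_i)$ be the $O$-scheme whose $S$-valued points are the families $(\mathcal{F}_i)_{0\le i\le m-1}$, where $\mathcal{F}_i\subseteq\Lambda_{i,S}:=\Lambda_i\otimes_O\mathcal{O}_S$ is a locally free submodule of rank $r$, Zariski-locally on $S$ a direct summand, with $\phi_i(\mathcal{F}_i)\subseteq\mathcal{F}_{i+1}$ for all $i$ (including $\phi_{m-1}(\mathcal{F}_{m-1})\subseteq\mathcal{F}_0$). It is called a generalized local model if all $\phi_i$ are diagonal matrices with only $1$'s and $\pi$'s on the diagonal (with respect to the fixed bases) and their composition is $\pi$. Open subsets. For $i=0,\dots,m-1$ choose $t_i\in\{0,1\}^n$ with $\#\{j;\ t_i(j)=1\}=r$, such that: (1) for all $j$, $(t_0(j),\dots,t_{m-1}(j))$ is a cyclic permutation of $(1^\kappa,0^{m-\kappa})$ for some $\kappa$; (2) if $t_i(j)=1$ and $t_{i+1}(j)=0$, then $\phi_i(e^i_j)=\pi e^{i+1}_j$. Then $U((t_i)_i)$ is the open subset of $M(m,n,r,(\phi_i)_i)$ where, for every $i$, $\Lambda_{i,S}/\mathcal{F}_i$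 is generated by the $e^i_j$ with $t_i(j)=0$. The affine subspaces $\mathfrak{X}_i$. Let $S_0=\{\iota;\ t_i(\iota)=0\text{ for all }i\}$. For each $i$ let $j^i_1,\dots,j^i_{n-r-s}$ be an enumeration of the $j\notin S_0$ with $t_i(j)=0$. Let $\varepsilon^i_j=0$ if $\phi_i(e^i_j)=e^{i+1}_j$ and $\varepsilon^i_j=1$ if $\phi_i(e^i_j)=\pi e^{i+1}_j$. Then $\mathfrak{X}_i$ is the affine subspace of matrices $X=(x_{\mu,\nu})_{\mu,\nu}\in\operatorname{Mat}_{n-r-s}$ such that for every $\iota\in\{1,\dots,n-r-s\}$ with $t_{i+1}(j^i_\iota)=0$, so that $j:=j^i_\iota=j^{i+1}_{\iota'}$ for some $\iota'$, one has $x_{\mu,\iota}=\pi^{\varepsilon^i_j}\delta_{\mu,\iota'}$ for all $\mu=1,\dots,n-r-s$. The scheme $W$ is the closed subscheme of $\prod_i\mathfrak{X}_i$ (an affine space over $O$) defined by the displayed matrix equations. *)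

(* Defs.v *)
From HB Require Import structures.
From mathcomp Require Import all_boot all_order all_algebra separable.
From mathcomp Require Import generic_quotient ring boolp classical_sets.

Set Implicit Arguments.
Unset Strict Implicit.
Unset Printing Implicit Defensive.

Import GRing.Theory.
Local Open Scope ring_scope.
Local Open Scope quotient_scope.

Definition submodule (R : pzRingType) (V : lmodType R) (F : set V) : Prop :=
  F 0 /\ forall (a : R) (x y : V), F x -> F y -> F (a *: x + y).

(* The submodule of R'^n spanned by the image of F.  If F is, locally, a direct
   summand of R^n, then this is F tensored with R', seen inside R'^n. *)
Definition base_change (R R' : pzRingType) (h : R -> R') (n : nat)
    (F : set 'cV[R]_n) : set 'cV[R']_n :=
  smallest (@submodule R' 'cV[R']_n) [set map_mx h x | x in F]%classic.

Definition free_of_rank (R : pzRingType) (n r : nat) (F : set 'cV[R]_n) : Prop :=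
  exists V : 'M[R]_(n, r),
    injective (fun c : 'cV[R]_r => V *m c)
    /\ F = range (fun c : 'cV[R]_r => V *m c).

Definition direct_summand (R : pzRingType) (V : lmodType R) (F : set V) : Prop :=
  exists G : set V,
    [/\ submodule G,
        forall x, exists y z, [/\ F y, G z & x = y + z]
      & (F `&` G = [set 0])%classic].

(* loc f is the localization R_f = R[1/f]. *)
Section Localization.
Variables (R : comPzRingType) (f : R).

(* The pair (a, k) stands for a / f^k. *)
Definition loc_rel (x y : R * nat) : bool :=
  `[< exists N, f ^+ N * (x.1 * f ^+ y.2) = f ^+ N * (y.1 * f ^+ x.2) >].

Lemma loc_rel_refl : reflexive loc_rel.
Proof. by move=> x; apply/asboolP; exists 0%N. Qed.

Lemma loc_rel_sym : symmetric loc_rel.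
Proof. by move=> x y; apply/asboolP/asboolP => -[N hN]; exists N. Qed.

Lemma loc_rel_trans : transitive loc_rel.
Proof.
move=> [b l] [a k] [c p] /asboolP[/= N hN] /asboolP[/= N' hN'].
apply/asboolP; exists (N + N' + l)%N => /=; rewrite !exprD.
transitivity (f ^+ N' * f ^+ p * (f ^+ N * (a * f ^+ l))); first by ring.
rewrite hN; transitivity (f ^+ N * f ^+ k * (f ^+ N' * (b * f ^+ p))); first by ring.
by rewrite hN'; ring.
Qed.

Canonical loc_equiv := EquivRel loc_rel loc_rel_refl loc_rel_sym loc_rel_trans.

Definition loc := {eq_quot loc_equiv}.
HB.instance Definition _ := EqQuotient.on loc.
HB.instance Definition _ := Choice.on loc.

Lemma loc_eqP (x y : R * nat) :
  (exists N, f ^+ N * (x.1 * f ^+ y.2) = f ^+ N * (y.1 * f ^+ x.2)) <->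
  \pi_loc x = \pi_loc y.
Proof. by split=> [h|/eqmodP /asboolP //]; apply/eqmodP/asboolP. Qed.

Definition loc_add (x y : loc) : loc :=
  \pi_loc ((repr x).1 * f ^+ (repr y).2 + (repr y).1 * f ^+ (repr x).2,
           ((repr x).2 + (repr y).2)%N).
Definition loc_opp (x : loc) : loc := \pi_loc (- (repr x).1, (repr x).2).
Definition loc_mul (x y : loc) : loc :=
  \pi_loc ((repr x).1 * (repr y).1, ((repr x).2 + (repr y).2)%N).
Definition loc_of (a : R) : loc := \pi_loc (a, 0%N).

Lemma loc_reprP (x : R * nat) :
  exists N, f ^+ N * ((repr (\pi_loc x)).1 * f ^+ x.2)
          = f ^+ N * (x.1 * f ^+ (repr (\pi_loc x)).2).
Proof. by apply/loc_eqP; rewrite reprK. Qed.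

Lemma loc_addE (x y : R * nat) :
  loc_add (\pi x) (\pi y) =
  \pi_loc (x.1 * f ^+ y.2 + y.1 * f ^+ x.2, (x.2 + y.2)%N).
Proof.
apply/loc_eqP => /=; have [N hN] := loc_reprP x; have [N' hN'] := loc_reprP y.
move: (repr (\pi_loc x)) (repr (\pi_loc y)) hN hN' => [a k] [b l] /=.
case: x y => [a' k'] [b' l'] /= hN hN'.
exists (N + N')%N; rewrite !exprD.
transitivity (f ^+ N' * f ^+ l * f ^+ l' * (f ^+ N * (a * f ^+ k'))
   + f ^+ N * f ^+ k * f ^+ k' * (f ^+ N' * (b * f ^+ l'))); first by ring.
by rewrite hN hN'; ring.
Qed.

Lemma loc_oppE (x : R * nat) : loc_opp (\pi x) = \pi_loc (- x.1, x.2).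
Proof.
apply/loc_eqP => /=; have [N hN] := loc_reprP x.
by exists N; rewrite !mulNr !mulrN hN.
Qed.

Lemma loc_mulE (x y : R * nat) :
  loc_mul (\pi x) (\pi y) = \pi_loc (x.1 * y.1, (x.2 + y.2)%N).
Proof.
apply/loc_eqP => /=; have [N hN] := loc_reprP x; have [N' hN'] := loc_reprP y.
move: (repr (\pi_loc x)) (repr (\pi_loc y)) hN hN' => [a k] [b l] /=.
case: x y => [a' k'] [b' l'] /= hN hN'.
exists (N + N')%N; rewrite !exprD.
transitivity ((f ^+ N * (a * f ^+ k')) * (f ^+ N' * (b * f ^+ l'))); first by ring.
by rewrite hN hN'; ring.
Qed.

Lemma loc_ind (P : loc -> Prop) : (forall x, P (\pi x)) -> forall x, P x.
Proof. by move=> h x; rewrite -[x]reprK. Qed.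

Lemma loc_eq (x y : R * nat) :
  x.1 * f ^+ y.2 = y.1 * f ^+ x.2 -> \pi_loc x = \pi_loc y.
Proof. by move=> h; apply/loc_eqP; exists 0%N; rewrite h. Qed.

Lemma loc_addA : associative loc_add.
Proof.
move=> x y z; elim/loc_ind: x => x; elim/loc_ind: y => y; elim/loc_ind: z => z.
by rewrite !loc_addE; apply: loc_eq; rewrite /= !exprD; ring.
Qed.

Lemma loc_addC : commutative loc_add.
Proof.
move=> x y; elim/loc_ind: x => x; elim/loc_ind: y => y.
by rewrite !loc_addE; apply: loc_eq; rewrite /= !exprD; ring.
Qed.

Lemma loc_add0 : left_id (loc_of 0) loc_add.
Proof.
move=> x; elim/loc_ind: x => x.
by rewrite /loc_of !loc_addE; apply: loc_eq; rewrite /= ?exprD expr0; ring.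
Qed.

Lemma loc_addN : left_inverse (loc_of 0) loc_opp loc_add.
Proof.
move=> x; elim/loc_ind: x => x.
by rewrite /loc_of loc_oppE !loc_addE; apply: loc_eq; rewrite /= ?exprD expr0; ring.
Qed.

HB.instance Definition _ :=
  GRing.isZmodule.Build loc loc_addA loc_addC loc_add0 loc_addN.

Lemma loc_mulA : associative loc_mul.
Proof.
move=> x y z; elim/loc_ind: x => x; elim/loc_ind: y => y; elim/loc_ind: z => z.
by rewrite !loc_mulE; apply: loc_eq; rewrite /= !exprD; ring.
Qed.

Lemma loc_mulC : commutative loc_mul.
Proof.
move=> x y; elim/loc_ind: x => x; elim/loc_ind: y => y.
by rewrite !loc_mulE; apply: loc_eq; rewrite /= !exprD; ring.
Qed.

Lemma loc_mul1 : left_id (loc_of 1) loc_mul.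
Proof.
move=> x; elim/loc_ind: x => x.
by rewrite /loc_of !loc_mulE; apply: loc_eq; rewrite /= ?exprD; ring.
Qed.

Lemma loc_mulDl : left_distributive loc_mul loc_add.
Proof.
move=> x y z; elim/loc_ind: x => x; elim/loc_ind: y => y; elim/loc_ind: z => z.
by rewrite !(loc_mulE, loc_addE); apply: loc_eq; rewrite /= !exprD; ring.
Qed.

HB.instance Definition _ :=
  GRing.Zmodule_isComPzRing.Build loc loc_mulA loc_mulC loc_mul1 loc_mulDl.

Lemma loc_of_is_zmod_morphism : zmod_morphism loc_of.
Proof.
move=> a b; rewrite -[RHS]/(loc_add (loc_of a) (loc_opp (loc_of b))).
by rewrite /loc_of loc_oppE loc_addE; apply: loc_eq; rewrite /= expr0; ring.
Qed.

Lemma loc_of_is_monoid_morphism : monoid_morphism loc_of.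
Proof.
split=> // a b; rewrite -[RHS]/(loc_mul (loc_of a) (loc_of b)).
by rewrite /loc_of loc_mulE; apply: loc_eq.
Qed.

HB.instance Definition _ :=
  GRing.isZmodMorphism.Build R loc loc_of loc_of_is_zmod_morphism.
HB.instance Definition _ :=
  GRing.isMonoidMorphism.Build R loc loc_of loc_of_is_monoid_morphism.

Lemma loc_of_inv : exists b : loc, loc_of f * b = 1.
Proof.
exists (\pi_loc (1, 1%N)); rewrite -[LHS]/(loc_mul _ _) -[RHS]/(loc_of 1).
by rewrite /loc_of loc_mulE; apply: loc_eq; rewrite /= expr0 add0n expr1; ring.
Qed.

Lemma loc_lift (B : comPzRingType) (h : {rmorphism R -> B}) (b : B) :
  h f * b = 1 ->
  exists hh : {rmorphism loc -> B}, forall a, hh (loc_of a) = h a.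
Proof.
move=> hb; pose g (x : loc) := h (repr x).1 * b ^+ (repr x).2.
have hbn k : h f ^+ k * b ^+ k = 1 by rewrite -exprMn hb expr1n.
have gE x : g (\pi x) = h x.1 * b ^+ x.2.
  rewrite /g; have [N /(congr1 h)] := loc_reprP x.
  move: (repr _) => [a k]; case: x => [a' k'] /=.
  rewrite !rmorphM !rmorphXn => e.
  transitivity (b ^+ N * b ^+ k * b ^+ k' * (h f ^+ N * (h a * h f ^+ k'))).
    transitivity ((h f ^+ N * b ^+ N) * (h f ^+ k' * b ^+ k') * (h a * b ^+ k)).
      by rewrite !hbn !mul1r.
    by ring.
  rewrite e.
  transitivity ((h f ^+ N * b ^+ N) * (h f ^+ k * b ^+ k) * (h a' * b ^+ k')).
    by ring.
  by rewrite !hbn !mul1r.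
have gB : zmod_morphism g.
  move=> x y; elim/loc_ind: x => -[a k]; elim/loc_ind: y => -[c l].
  rewrite -[_ - _]/(loc_add _ (loc_opp _)) loc_oppE loc_addE !gE /=.
  rewrite rmorphD !rmorphM rmorphN !rmorphXn exprD.
  transitivity ((h f ^+ l * b ^+ l) * (h a * b ^+ k)
                - (h f ^+ k * b ^+ k) * (h c * b ^+ l)); first by ring.
  by rewrite !hbn !mul1r.
have gM : monoid_morphism g.
  split; first by rewrite -[1]/(loc_of 1) gE /= rmorph1 mulr1.
  move=> x y; elim/loc_ind: x => -[a k]; elim/loc_ind: y => -[c l].
  by rewrite -[_ * _ in LHS]/(loc_mul _ _) loc_mulE !gE /= rmorphM exprD; ring.
pose gA := GRing.isZmodMorphism.Build loc B g gB.
pose gR := GRing.isMonoidMorphism.Build loc B g gM.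
pose hh : {rmorphism loc -> B} := HB.pack g gA gR.
by exists hh => a; rewrite /= gE /= mulr1.
Qed.

End Localization.

(* F is locally free of rank r and, Zariski-locally on Spec R, a direct summand
   of R^n: this holds over the members of a cover by principal opens D(f_i). *)
Definition locally_free_summand (R : comPzRingType) (n r : nat)
    (F : set 'cV[R]_n) : Prop :=
  submodule F /\
  exists (k : nat) (f : 'I_k -> R),
    (exists c : 'I_k -> R, \sum_(i < k) c i * f i = 1) /\
    forall i : 'I_k,
      free_of_rank r (base_change (loc_of (f i)) F) /\
      direct_summand (base_change (loc_of (f i)) F).

Section BaseChange.

Lemma submodule_base_change (R R' : pzRingType) (h : R -> R') n
    (F : set 'cV[R]_n) : submodule (base_change h F).
Proof.
split=> [G [[G0 _] _] //|a x y hx hy G hG]; have [[_ Gl] _] := hG.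
by apply: Gl; [apply: hx | apply: hy].
Qed.

Lemma base_change_in (R R' : pzRingType) (h : R -> R') n
    (F : set 'cV[R]_n) x : F x -> base_change h F (map_mx h x).
Proof. by move=> Fx G [_]; apply; exists x. Qed.

Lemma base_change_min (R R' : pzRingType) (h : R -> R') n
    (F : set 'cV[R]_n) (G : set 'cV[R']_n) :
  submodule G -> (forall x, F x -> G (map_mx h x)) ->
  forall y, base_change h F y -> G y.
Proof. by move=> sG hG y; apply; split=> // _ [x Fx <-]; exact: hG. Qed.

Lemma base_change_id (R : pzRingType) n (F : set 'cV[R]_n) (h : R -> R) :
  h =1 id -> submodule F -> base_change h F = F.
Proof.
move=> hid sF; have hx (x : 'cV[R]_n) : map_mx h x = x.
  by apply/matrixP => i j; rewrite mxE hid.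
apply/seteqP; split=> x.
  by apply: base_change_min => // z; rewrite hx.
by move=> Fx; rewrite -[x]hx; exact: base_change_in.
Qed.

Lemma base_change_comp (R R' R'' : pzRingType) (h : R -> R')
    (g : {rmorphism R' -> R''}) (gh : R -> R'') n (F : set 'cV[R]_n) :
  (forall a, gh a = g (h a)) ->
  base_change g (base_change h F) = base_change gh F.
Proof.
move=> e; have eM (x : 'cV[R]_n) : map_mx gh x = map_mx g (map_mx h x).
  by apply/matrixP => i j; rewrite !mxE.
apply/seteqP; split=> y.
  apply: base_change_min; first exact: submodule_base_change.
  move=> x; move: x.
  apply: (@base_change_min _ _ _ _ _
    (fun x => base_change gh F (map_mx g x))); last first.
    by move=> x Fx; rewrite -eM; exact: base_change_in.
  have [s0 sl] := submodule_base_change gh F.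
  split=> [|a x z hx hz]; first by rewrite map_mx0.
  by rewrite map_mxD map_mxZ; exact: sl.
apply: base_change_min; first exact: submodule_base_change.
by move=> x Fx; rewrite eM; do 2 apply: base_change_in.
Qed.

Lemma free_summandP (R : comPzRingType) n r (F : set 'cV[R]_n) :
  submodule F ->
  (free_of_rank r F /\ direct_summand F) <->
  exists (V : 'M[R]_(n, r)) (C : 'M[R]_(r, n)),
    C *m V = 1%:M /\ F = range (fun c : 'cV[R]_r => V *m c).
Proof.
move=> [F0 Fl]; split.
  case=> -[V [Vi FE]] [G [[G0 Gl] FG FG0]].
  have hj (j : 'I_n) : exists c : 'cV[R]_r, G (delta_mx j 0 - V *m c).
    have [y [z [Fy Gz e]]] := FG (delta_mx j 0).
    move: Fy; rewrite FE => -[c _ cy]; exists c; rewrite e -cy.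
    by rewrite addrC addKr.
  have [c hc] := choice hj.
  exists V, (\matrix_(i, j) c j i 0); set C := (\matrix_(_, _) _).
  split=> //.
  have hG (I : finType) (E : I -> R) (z : I -> 'cV[R]_n) :
    (forall i, G (z i)) -> G (\sum_i E i *: z i).
    by move=> Gz; elim/big_rec: _ => // i x _ Gx; exact: Gl.
  have hF (a : 'cV[R]_r) : V *m a - V *m (C *m (V *m a)) = 0.
    have : (F `&` G)%classic (V *m a - V *m (C *m (V *m a))).
      split.
        by rewrite FE; exists (a - C *m (V *m a)) => //; rewrite mulmxBr.
      set x := V *m a.
      suff -> : x - V *m (C *m x) =
          \sum_j x j 0 *: (delta_mx j 0 - V *m c j) by exact: hG.
      rewrite (eq_bigr (fun j =>
        x j 0 *: delta_mx j 0 - V *m (x j 0 *: c j))); last first.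
        by move=> j _; rewrite scalerBr scalemxAr.
      rewrite sumrB -mulmx_sumr; congr (_ - V *m _).
        apply/matrixP => i j; rewrite (ord1 j) summxE (bigD1 i) //= big1.
          by rewrite !mxE !eqxx mulr1 addr0.
        by move=> k /negPf ki; rewrite !mxE eq_sym ki mulr0.
      apply/matrixP => i j; rewrite (ord1 j) summxE mxE; apply: eq_bigr => k _.
      by rewrite !mxE mulrC.
    by rewrite FG0.
  have hV (a : 'cV[R]_r) : C *m V *m a = a.
    apply: Vi; rewrite /= -mulmxA; apply/esym/eqP; rewrite -subr_eq0.
    by apply/eqP; exact: hF.
  apply/matrixP => i j; have /matrixP/(_ i 0) := hV (delta_mx j 0).
  by rewrite -colE mxE => ->; rewrite !mxE eqxx andbT.
case=> V [C [CV FE]]; split.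
  exists V; split=> // a b /(congr1 (mulmx C)).
  by rewrite !mulmxA CV !mul1mx.
exists (fun x => C *m x = 0); split.
- split=> [|a x y hx hy]; first by rewrite mulmx0.
  by rewrite mulmxDr hy addr0 -scalemxAr hx scaler0.
- move=> x; exists (V *m (C *m x)), (x - V *m (C *m x)); split.
  + by rewrite FE; exists (C *m x).
  + by rewrite mulmxBr !mulmxA CV mul1mx subrr.
  + by rewrite addrC subrK.
- apply/seteqP; split=> x /=; last by move=> ->; rewrite mulmx0.
  by rewrite {1}FE => -[[c _ <-]]; rewrite mulmxA CV mul1mx => ->; rewrite mulmx0.
Qed.

Lemma base_change_range (R R' : comPzRingType) (h : {rmorphism R -> R'}) n r
    (V : 'M[R]_(n, r)) :
  base_change h (range (fun c : 'cV[R]_r => V *m c)) =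
  range (fun c : 'cV[R']_r => map_mx h V *m c).
Proof.
apply/seteqP; split=> y.
  apply: base_change_min => [|_ [c _ <-]]; last first.
    by exists (map_mx h c) => //; rewrite map_mxM.
  split=> [|a _ _ [c _ <-] [d _ <-]]; first by exists 0 => //; rewrite mulmx0.
  by exists (a *: c + d) => //; rewrite mulmxDr -scalemxAr.
case=> c _ <-.
have [s0 sl] := submodule_base_change h (range (fun c : 'cV[R]_r => V *m c)).
have -> : map_mx h V *m c = \sum_j c j 0 *: map_mx h (V *m delta_mx j 0).
  apply/matrixP => i k; rewrite (ord1 k) summxE mxE; apply: eq_bigr => j _.
  by rewrite -colE !mxE mulrC.
elim/big_rec: _ => // j x _ hx; apply: sl => //.
by apply: base_change_in; exists (delta_mx j 0).
Qed.

Lemma locally_free_summand_base_change (R R' : comPzRingType)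
    (h : {rmorphism R -> R'}) n r (F : set 'cV[R]_n) :
  locally_free_summand r F -> locally_free_summand r (base_change h F).
Proof.
case=> sF [k [f [[c cf] hF]]]; split; first exact: submodule_base_change.
exists k, (fun i => h (f i)); split.
  exists (fun i => h (c i)); rewrite -(rmorph1 h) -cf rmorph_sum.
  by apply: eq_bigr => i _; rewrite rmorphM.
move=> i; have [b hb] := loc_of_inv (h (f i)).
pose l' : {rmorphism R -> loc (h (f i))} := @loc_of _ (h (f i)) \o h.
have [hh hhE] := @loc_lift _ (f i) _ l' b hb.
apply/free_summandP; first exact: submodule_base_change.
have /free_summandP[|V [C [CV FE]]] := hF i; first exact: submodule_base_change.
exists (map_mx hh V), (map_mx hh C); split; first by rewrite -map_mxM CV map_mx1.
rewrite -base_change_range -FE (@base_change_comp _ _ _ _ _ l') //.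
by rewrite (@base_change_comp _ _ _ _ _ l').
Qed.

End BaseChange.

(* An O-scheme is represented by its functor of points on commutative
   O-algebras; by Yoneda and Zariski descent, O-schemes are isomorphic if and
   only if these functors are.  Unlike comAlgType, o_algebra allows the zero
   algebra. *)
Record o_algebra (O : comPzRingType) := OAlgebra {
  oalg_ring :> comPzRingType;
  oalg_str : {rmorphism O -> oalg_ring}
}.

Record o_hom (O : comPzRingType) (A B : o_algebra O) := OHom {
  o_hom_fun :> {rmorphism A -> B};
  o_hom_str : forall x : O, o_hom_fun (oalg_str A x) = oalg_str B x
}.

Section Functors.
Variable O : comPzRingType.
Implicit Types A B C : o_algebra O.

Definition o_id A : o_hom A A :=
  @OHom O A A (idfun : {rmorphism A -> A}) (fun=> erefl).

Lemma o_comp_str A B C (g : o_hom B C) (h : o_hom A B) (x : O) :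
  (g \o h) (oalg_str A x) = oalg_str C x.
Proof. by rewrite /= !o_hom_str. Qed.

Definition o_comp A B C (g : o_hom B C) (h : o_hom A B) : o_hom A C :=
  @OHom O A C (g \o h : {rmorphism A -> C}) (o_comp_str g h).

Record o_functor := OFunctor {
  points :> o_algebra O -> Type;
  pmap : forall A B, o_hom A B -> points A -> points B;
  pmap_id : forall A (x : points A), pmap (o_id A) x = x;
  pmap_comp : forall A B C (g : o_hom B C) (h : o_hom A B) (x : points A),
    pmap (o_comp g h) x = pmap g (pmap h x)
}.

Definition isomorphic (X Y : o_functor) : Prop :=
  exists eta : forall A, X A -> Y A,
    (forall A, bijective (eta A)) /\
    forall A B (h : o_hom A B) (x : X A), eta B (pmap h x) = pmap h (eta A x).

Section Subfunctor.
Variables (X : o_functor) (P : forall A, X A -> Prop).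
Hypothesis P_stable : forall A B (h : o_hom A B) (x : X A),
  P x -> P (pmap h x).

Definition sub_pmap A B (h : o_hom A B) (x : {x : X A | P x}) : {y : X B | P y} :=
  exist _ (pmap h (sval x)) (P_stable h (svalP x)).

Lemma sub_pmap_id A (x : {x : X A | P x}) : sub_pmap (o_id A) x = x.
Proof. by case: x => x Px; apply: eq_exist; exact: pmap_id. Qed.

Lemma sub_pmap_comp A B C (g : o_hom B C) (h : o_hom A B) (x : {x : X A | P x}) :
  sub_pmap (o_comp g h) x = sub_pmap g (sub_pmap h x).
Proof. by apply: eq_exist; exact: pmap_comp. Qed.

Definition subfunctor : o_functor := OFunctor sub_pmap_id sub_pmap_comp.
End Subfunctor.

Section Product.
Variables X Y : o_functor.

Definition prod_pmap A B (h : o_hom A B) (x : X A * Y A) : X B * Y B :=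
  (pmap h x.1, pmap h x.2).

Lemma prod_pmap_id A (x : X A * Y A) : prod_pmap (o_id A) x = x.
Proof. by case: x => x y; rewrite /prod_pmap !pmap_id. Qed.

Lemma prod_pmap_comp A B C (g : o_hom B C) (h : o_hom A B) (x : X A * Y A) :
  prod_pmap (o_comp g h) x = prod_pmap g (prod_pmap h x).
Proof. by rewrite /prod_pmap !pmap_comp. Qed.

Definition product : o_functor := OFunctor prod_pmap_id prod_pmap_comp.
End Product.

Section AffineSpace.
Variable N : nat.

Definition affine_pmap A B (h : o_hom A B) (x : 'rV[A]_N) : 'rV[B]_N := map_mx h x.

Lemma affine_pmap_id A (x : 'rV[A]_N) : affine_pmap (o_id A) x = x.
Proof. by apply/matrixP => i j; rewrite mxE. Qed.

Lemma affine_pmap_comp A B C (g : o_hom B C) (h : o_hom A B) (x : 'rV[A]_N) :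
  affine_pmap (o_comp g h) x = affine_pmap g (affine_pmap h x).
Proof. by apply/matrixP => i j; rewrite !mxE. Qed.

Definition affine_space : o_functor := OFunctor affine_pmap_id affine_pmap_comp.
End AffineSpace.

Section MatrixFamilies.
Variables m k : nat.

Definition mxfam_pmap A B (h : o_hom A B) (X : 'I_m -> 'M[A]_k) : 'I_m -> 'M[B]_k :=
  fun i => map_mx h (X i).

Lemma mxfam_pmap_id A (X : 'I_m -> 'M[A]_k) : mxfam_pmap (o_id A) X = X.
Proof. by apply/funext => i; apply/matrixP => a b; rewrite mxE. Qed.

Lemma mxfam_pmap_comp A B C (g : o_hom B C) (h : o_hom A B) (X : 'I_m -> 'M[A]_k) :
  mxfam_pmap (o_comp g h) X = mxfam_pmap g (mxfam_pmap h X).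
Proof. by apply/funext => i; apply/matrixP => a b; rewrite !mxE. Qed.

Definition matrix_families : o_functor := OFunctor mxfam_pmap_id mxfam_pmap_comp.
End MatrixFamilies.

End Functors.

Definition principal_ideal (O : comPzRingType) (a : O) : set O :=
  range (fun x : O => a * x).

Definition ideal (O : comPzRingType) (I : set O) : Prop :=
  @submodule O O^o I.

Definition prime_ideal (O : comPzRingType) (I : set O) : Prop :=
  [/\ ideal I, ~ I 1 & forall x y, I (x * y) -> I x \/ I y].

Definition discrete_valuation_ring (O : idomainType) : Prop :=
  (forall I : set O, ideal I -> exists a, I = principal_ideal a) /\
  exists! P : set O, prime_ideal P /\ P <> [set 0]%classic.

Definition uniformizer (O : idomainType) (pi : O) : Prop :=
  pi <> 0 /\ prime_ideal (principal_ideal pi).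

(* O -> lim O / pi^k is bijective. *)
Definition adically_complete (O : comPzRingType) (pi : O) : Prop :=
  forall a : nat -> O,
    (forall k, principal_ideal (pi ^+ k) (a k.+1 - a k)) ->
    exists! l : O, forall k, principal_ideal (pi ^+ k) (l - a k).

Definition perfect_field (k : fieldType) : Prop :=
  forall p : {poly k}, irreducible_poly p -> separable_poly p.

Definition perfect_residue_field (O : comPzRingType) (pi : O) : Prop :=
  exists (k : fieldType) (res : {rmorphism O -> k}),
    [/\ forall y, exists x, res x = y,
        forall x, res x = 0 <-> principal_ideal pi x
      & perfect_field k].

Definition complete_dvr_perfect (O : idomainType) (pi : O) : Prop :=
  [/\ discrete_valuation_ring O, uniformizer pi, adically_complete pi
    & perfect_residue_field pi].

(* Vectors are columns and evec j is the j-th vector of the fixed basis, so that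
   the matrix phi i represents the map from Lambda_i to Lambda_{i+1}; indices
   in 'I_m are read modulo m, with successor ordS. *)
Definition evec (R : pzRingType) (n : nat) (j : 'I_n) : 'cV[R]_n := delta_mx j 0.
Arguments evec {R n} j.

Section CompatibleSubspaces.
Variables (O : comPzRingType) (m n r : nat) (phi : 'I_m -> 'M[O]_n).
Implicit Types A B C : o_algebra O.

Definition compatible_family A (F : 'I_m -> set 'cV[A]_n) : Prop :=
  (forall i, locally_free_summand r (F i)) /\
  forall i x, F i x -> F (ordS i) (map_mx (oalg_str A) (phi i) *m x).

Lemma compatible_family_base_change A B (h : o_hom A B) (F : 'I_m -> set 'cV[A]_n) :
  compatible_family F -> @compatible_family B (fun i => base_change h (F i)).
Proof.
case=> hF hc; split=> [i|i x]; first exact: locally_free_summand_base_change.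
move: x; apply: (@base_change_min _ _ _ _ _ (fun x =>
  base_change h (F (ordS i)) (map_mx (oalg_str B) (phi i) *m x))).
  have [s0 sl] := submodule_base_change h (F (ordS i)).
  split=> [|a x y hx hy]; first by rewrite mulmx0.
  by rewrite mulmxDr -scalemxAr; exact: sl.
move=> x Fx; have -> : map_mx (oalg_str B) (phi i) =
    map_mx h (map_mx (oalg_str A) (phi i)).
  by apply/matrixP => a b; rewrite !mxE o_hom_str.
by rewrite -map_mxM; apply: base_change_in; exact: hc.
Qed.

Definition M_points A := {F : 'I_m -> set 'cV[A]_n | compatible_family F}.

Definition M_pmap A B (h : o_hom A B) (F : M_points A) : M_points B :=
  exist _ (fun i => base_change h (sval F i))
    (compatible_family_base_change h (svalP F)).

Lemma M_pmap_id A (F : M_points A) : M_pmap (o_id A) F = F.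
Proof.
case: F => F [lF cF]; apply: eq_exist; apply/funext => i /=.
by apply: base_change_id => //; have [] := lF i.
Qed.

Lemma M_pmap_comp A B C (g : o_hom B C) (h : o_hom A B) (F : M_points A) :
  M_pmap (o_comp g h) F = M_pmap g (M_pmap h F).
Proof.
by apply: eq_exist; apply/funext => i /=; apply/esym/base_change_comp.
Qed.

Definition compatible_subspaces : o_functor O := OFunctor M_pmap_id M_pmap_comp.

(* The quotient of Lambda_i by F_i is generated by the evec j with t_i(j) = 0. *)
Definition quotients_generated (t : 'I_m -> 'I_n -> bool) A
    (F : compatible_subspaces A) : Prop :=
  forall i (x : 'cV[A]_n), exists c : 'I_n -> A,
    sval F i (x - \sum_(j | ~~ t i j) c j *: evec j).

Lemma quotients_generated_stable t A B (h : o_hom A B) (F : compatible_subspaces A) :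
  quotients_generated t F -> quotients_generated t (pmap h F).
Proof.
move=> gF i x; have [s0 sl] := submodule_base_change h (sval F i).
have [c hc] := choice (fun j : 'I_n => gF i (evec j)).
exists (fun k => \sum_j x j 0 * h (c j k)).
have -> : x - \sum_(k | ~~ t i k) (\sum_j x j 0 * h (c j k)) *: evec k =
    \sum_j x j 0 *: map_mx h (evec j - \sum_(k | ~~ t i k) c j k *: evec k).
  under [RHS]eq_bigr => j _ do
    rewrite map_mxB map_delta_mx raddf_sum /= scalerBr scaler_sumr.
  rewrite sumrB; congr (_ - _).
    apply/matrixP => a b; rewrite (ord1 b) summxE (bigD1 a) //= big1.
      by rewrite !mxE !eqxx mulr1 addr0.
    by move=> k /negPf ka; rewrite !mxE eq_sym ka mulr0.
  rewrite exchange_big /=; apply: eq_bigr => k _.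
  rewrite scaler_suml; apply: eq_bigr => j _.
  by rewrite map_mxZ map_delta_mx scalerA.
elim/big_rec: _ => // j y _ hy; apply: sl => //.
exact: base_change_in.
Qed.

Definition scheme_U (t : 'I_m -> 'I_n -> bool) : o_functor O :=
  subfunctor (@quotients_generated_stable t).

End CompatibleSubspaces.

Definition generalized_local_model (O : comPzRingType) (pi : O) (m n : nat)
    (phi : 'I_m -> 'M[O]_n) : Prop :=
  [/\ forall i, is_diag_mx (phi i),
      forall i j, phi i j j = 1 \/ phi i j j = pi
    & \prod_(i < m) phi (rev_ord i) = pi%:M].

Definition admissible (O : comPzRingType) (pi : O) (m n r : nat)
    (phi : 'I_m -> 'M[O]_n) (t : 'I_m -> 'I_n -> bool) : Prop :=
  [/\ forall i, #|[pred j | t i j]| = r,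
      forall j, exists kappa d : nat, (kappa <= m)%N /\
        [seq t i j | i <- enum 'I_m] =
          rot d (nseq kappa true ++ nseq (m - kappa) false)
    & forall i j, t i j -> ~~ t (ordS i) j ->
        phi i *m evec j = pi *: evec j].

Definition always0 (m n : nat) (t : 'I_m -> 'I_n -> bool) : pred 'I_n :=
  [pred j | [forall i, ~~ t i j]].
Definition always1 (m n : nat) (t : 'I_m -> 'I_n -> bool) : pred 'I_n :=
  [pred j | [forall i, t i j]].

(* For each i, js i lists without repetition the j outside S_0 = always0 t with
   t_i(j) = 0. *)
Definition enumeration (m n k : nat) (t : 'I_m -> 'I_n -> bool)
    (js : 'I_m -> 'I_k -> 'I_n) : Prop :=
  forall i, injective (js i) /\
    codom (js i) =i [pred j | (j \notin always0 t) && ~~ t i j].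

Definition eps (O : comPzRingType) (m n : nat) (phi : 'I_m -> 'M[O]_n)
    (i : 'I_m) (j : 'I_n) : nat :=
  if phi i *m evec j == evec j then 0%N else 1%N.

(* X_{i-1} ... X_{i+1} X_i, with m factors. *)
Definition cyclic_product (R : pzRingType) (m k : nat) (X : 'I_m -> 'M[R]_k)
    (i : 'I_m) : 'M[R]_k :=
  \prod_(l < m) X (iter (rev_ord l) (@ordS m) i).

Section SchemeW.
Variables (O : comPzRingType) (pi : O) (m n k : nat) (phi : 'I_m -> 'M[O]_n).
Variables (t : 'I_m -> 'I_n -> bool) (js : 'I_m -> 'I_k -> 'I_n).
Implicit Types A B : o_algebra O.

Definition in_X A (i : 'I_m) (X : 'M[A]_k) : Prop :=
  forall a a' : 'I_k, ~~ t (ordS i) (js i a) -> js i a = js (ordS i) a' ->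
  forall mu, X mu a =
    oalg_str A pi ^+ eps phi i (js i a) * (mu == a')%:R.

Definition in_W A (X : matrix_families O m k A) : Prop :=
  (forall i, in_X i (X i)) /\
  forall i, cyclic_product X i = (oalg_str A pi)%:M.

Lemma in_W_stable A B (h : o_hom A B) (X : matrix_families O m k A) :
  in_W X -> in_W (pmap h X).
Proof.
case=> hX hp; split=> [i a a' ta ja mu|i].
  by rewrite mxE (hX i a a' ta ja) rmorphM rmorphXn o_hom_str rmorph_nat.
rewrite -(o_hom_str h) -map_scalar_mx -(hp i) /cyclic_product.
apply/esym; elim/big_rec2: _ => [|l Y Z _ <-]; first exact: map_mx1.
exact: map_mxM.
Qed.

Definition scheme_W : o_functor O := subfunctor in_W_stable.

End SchemeW.

(* Main.v *)
Require Import Defs.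
From mathcomp Require Import all_boot all_order all_algebra.
From mathcomp Require Import boolp classical_sets zify.

(** The theorem is linear algebra over an arbitrary O-algebra A, done naturally
    in A.

    In the chart U the vectors e_j with t_i(j) = 0 form a basis of the quotient
    by F_i: they generate it and their number is its rank ([supported_eq0]). So
    F_i is the kernel of a unique projector P_i with image the span of these
    e_j, and the compatibility of the F_i becomes P_(i+1) phi_i = P_(i+1) phi_i
    P_i ([projectors_isomorphic]).

    Since the diagonal maps phi_i compose to pi and pi is a nonzero nonunit of
    a domain, for each j there is exactly one transition c(j) at which e_j is
    multiplied by pi; at all others it is sent to e_j
    ([generalized_local_model_diag]). As phi_i multiplies e_j by pi wherever
    t_i(j) drops from 1 to 0, this can happen at i = c(j) only.

    Let S_0 be the set of indices j with t_i(j) = 0 for all i, and S_1 the set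
    of those with t_i(j) = 1 for all i. Divide the i-th quotient further by the
    e_j with j in S_0, let R_i be the projection to the result, and X_i the map
    which phi_i induces. Then R_(i+1) phi_i = X_i R_i, and the cyclic products
    of the X_i are pi; when t_i(j) and t_(i+1)(j) both vanish, X_i sends e_j to
    pi or 1 times e_j. This is the point (X_i) of W. Conversely, column j of
    the R_i is obtained by applying the X_i successively, starting from i =
    c(j) + 1, as phi_i fixes e_j up to the next passage through c(j). The
    starting column is 0 for j in S_0, arbitrary for j in S_1 (whence t (n-r-s)
    parameters), and a basis vector for the other j, for which t vanishes right
    after c(j). At c(j) the required relation is that the whole cyclic product
    is pi, which is the equation of W.

    It remains to recover the coordinates of the projectors in S_0. Row y of
    P_i is a functional on the kernel of R_i, and these functionals are
    compatible up to the factor by which phi_i acts on e_y. So they are the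
    pullbacks of the one at i = c(y), which is arbitrary (r parameters for each
    of the s indices); the relation at c(y) holds because the phi_i compose to
    pi.

    Thus (X_i), the free columns and the free rows determine the projectors
    ([coordinates_inj]) and can be prescribed ([reconstruction]). *)

Set Implicit Arguments.
Unset Strict Implicit.
Unset Printing Implicit Defensive.

Import GRing.Theory.
Local Open Scope ring_scope.

(** * Isomorphisms of functors of points *)

Section Isomorphisms.
Variable O : comPzRingType.
Implicit Types X Y Z : o_functor O.

Lemma isomorphic_sym X Y : isomorphic X Y -> isomorphic Y X.
Proof.
case=> eta [bij nat].
have inv_ex A : exists g : Y A -> X A, cancel (eta A) g /\ cancel g (eta A).
  by have [g gK Kg] := bij A; exists g.
pose g A := sval (cid (inv_ex A)).
have gK A : cancel (eta A) (g A) by rewrite /g; case: cid => ? [].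
have Kg A : cancel (g A) (eta A) by rewrite /g; case: cid => ? [].
exists g; split=> [A|A B h y]; first by exists (eta A).
by rewrite -{1}[y]Kg -nat gK.
Qed.

Lemma isomorphic_trans X Y Z :
  isomorphic X Y -> isomorphic Y Z -> isomorphic X Z.
Proof.
case=> f [fb fn] [g [gb gn]]; exists (fun A => g A \o f A).
split=> [A|A B h x /=]; first exact: bij_comp.
by rewrite fn gn.
Qed.

Lemma isomorphic_of_inj_surj X Y (eta : forall A, X A -> Y A) :
  (forall A, injective (eta A)) ->
  (forall A y, exists x, eta A x = y) ->
  (forall A B (h : o_hom A B) x,
     eta B (Defs.pmap h x) = Defs.pmap h (eta A x)) ->
  isomorphic X Y.
Proof.
move=> inj surj nat; exists eta; split=> // A.
have [g gP] := choice (surj A).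
by exists g => // x; apply: inj; rewrite gP.
Qed.

End Isomorphisms.

(** * Travelling around the cycle *)

Section Cycle.
Variable m : nat.
Implicit Types i j c : 'I_m.

Lemma val_ordS i : ordS i = (if i.+1 == m then 0 else i.+1) :> nat.
Proof.
have := ltn_ord i; rewrite /=; case: eqP => [->|? ?]; first by rewrite modnn.
by rewrite modn_small //; lia.
Qed.

(** The number of applications of [ordS] that lead from [i] to [j]. *)
Definition cdist i j : nat := if (i <= j)%N then (j - i)%N else (m + j - i)%N.

Lemma ltn_cdist i j : (cdist i j < m)%N.
Proof.
have ? := ltn_ord i; have ? := ltn_ord j.
by rewrite /cdist; case: (leqP i j) => ?; lia.
Qed.

Lemma cdistii i : cdist i i = 0%N.
Proof. by rewrite /cdist leqnn subnn. Qed.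

Lemma ord_neq i j : i != j -> (i : nat) <> j.
Proof. by move=> /eqP ij /val_inj. Qed.

Lemma cdist_ordS i j : cdist (ordS i) (ordS j) = cdist i j.
Proof.
rewrite /cdist !val_ordS; have ? := ltn_ord i; have ? := ltn_ord j.
by case: eqP => ?; case: eqP => ?; case: leqP => ?; case: leqP => ?; lia.
Qed.

Lemma cdistSl i c : i != c -> cdist i c = (cdist (ordS i) c).+1.
Proof.
move=> /ord_neq ?; rewrite /cdist !val_ordS.
have ? := ltn_ord i; have ? := ltn_ord c.
by case: eqP => ?; case: leqP => ?; case: leqP => ?; lia.
Qed.

Lemma cdist_last c : (cdist (ordS c) c).+1 = m.
Proof.
rewrite /cdist !val_ordS; have ? := ltn_ord c.
by case: eqP => ?; case: leqP => ?; lia.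
Qed.

Lemma iter_cdist i j : iter (cdist i j) (@ordS m) i = j.
Proof.
move Ed: (cdist i j) => d; elim: d i Ed => [|d IH] i Ed.
  apply: val_inj; move: Ed; rewrite /cdist /=.
  by have ? := ltn_ord i; have ? := ltn_ord j; case: leqP => ?; lia.
have ij : i != j by apply: contraPneq Ed => ->; rewrite cdistii.
by rewrite iterSr IH //; move: Ed; rewrite cdistSl // => -[].
Qed.

Lemma iter_ordS_period i : iter m (@ordS m) i = i.
Proof.
transitivity (iter (cdist (ordS i) i).+1 (@ordS m) i).
  by rewrite cdist_last.
by rewrite iterSr iter_cdist.
Qed.

(** Going once around the cycle from [ordS c] to [c] meets every index and uses
    every transition except the one out of [c].  Below, [c] is the transition at
    which a given basis vector is multiplied by the uniformizer, across which
    nothing can be propagated. *)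
Lemma cycle_ind c (Q : 'I_m -> Prop) :
  Q (ordS c) -> (forall i, i != c -> Q i -> Q (ordS i)) -> forall i, Q i.
Proof.
move=> Q0 QS i; move Ed: (cdist (ordS c) i) => d; elim: d i Ed => [|d IH] i Ed.
  by rewrite -(iter_cdist (ordS c) i) Ed.
rewrite -(ord_predK i) in Ed *; set j := ord_pred i in Ed *.
have jc : j != c by apply: contraPneq Ed => ->; rewrite cdistii.
apply: QS => //; apply: IH.
by move: Ed; rewrite cdist_ordS cdistSl 1?eq_sym // => -[].
Qed.

Lemma cycle_ind_back c (Q : 'I_m -> Prop) :
  Q c -> (forall i, i != c -> Q (ordS i) -> Q i) -> forall i, Q i.
Proof.
move=> Q0 QS i; move Ed: (cdist i c) => d; elim: d i Ed => [|d IH] i Ed.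
  by rewrite -(iter_cdist i c) Ed in Q0.
have ic : i != c by apply: contraPneq Ed => ->; rewrite cdistii.
by apply: QS => //; apply: IH; move: Ed; rewrite cdistSl // => -[].
Qed.

End Cycle.

Section Chain.
Variables (m : nat) (R : pzRingType) (k : nat) (X : 'I_m -> 'M[R]_k).

(** The partial products X_(i+l-1) ... X_(i+1) X_i of a cyclic product.  They
    are peeled off on the right by definition, on the left by [chainSr]: the
    columns of the quotient maps are propagated forward, the rows of the
    subspaces backward. *)
Fixpoint chain (i : 'I_m) (l : nat) : 'M[R]_k :=
  if l is l'.+1 then chain (ordS i) l' *m X i else 1%:M.

Lemma chainSr i l : chain i l.+1 = X (iter l (@ordS m) i) *m chain i l.
Proof.
elim: l i => [|l IH] i /=; first by rewrite mul1mx mulmx1.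
by rewrite -iterS iterSr mulmxA -IH; congr (_ * _).
Qed.

Lemma cyclic_productE i : cyclic_product X i = chain i m.
Proof.
rewrite /cyclic_product.
suff H l : \prod_(q < l) X (iter (rev_ord q) (@ordS m) i) = chain i l.
  exact: H.
elim: l => [|l IH]; first by rewrite big_ord0.
rewrite chainSr big_ord_recl /= subn1 /= -IH; congr (_ * _).
Qed.

End Chain.

(** * Selections of indices *)

Section Selections.

Lemma enumerate (T : finType) (p : pred T) (k : nat) :
  #|p| = k -> exists f : 'I_k -> T, injective f /\ codom f =i p.
Proof.
move=> <-; exists enum_val; split; first exact: enum_val_inj.
move=> x; apply/codomP/idP => [[a ->]|px]; first exact: enum_valP.
by exists (enum_rank_in px x); rewrite enum_rankK_in.
Qed.

Lemma sum_codom (V : nmodType) (I T : finType) (f : I -> T) (G : T -> V) :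
  injective f -> (forall x, x \notin codom f -> G x = 0) ->
  \sum_x G x = \sum_a G (f a).
Proof.
move=> f_inj G0.
rewrite (bigID (fun x => x \in codom f)) /= [X in _ + X]big1 //.
rewrite addr0 -big_uniq /= ?big_image //.
by rewrite map_inj_uniq // enum_uniq.
Qed.

Lemma extend_along (I : finType) (U : eqType) (V : Type) (f : I -> U)
    (g : I -> V) (v0 : V) :
  injective f -> exists h : U -> V, forall a, h (f a) = g a.
Proof.
move=> f_inj.
exists (fun x => if [pick a | f a == x] is Some a then g a else v0).
by move=> a; case: pickP => [b /eqP/f_inj -> //|/(_ a)]; rewrite eqxx.
Qed.

End Selections.

(** * Zariski-local vanishing *)

(** In a = sum c_i (f_i a), each f_i a is killed by the same powers as a, but
    with the exponent of f_i lowered by one: the total exponent decreases. *)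
Lemma cover_torsion (R : comPzRingType) (k : nat) (f c : 'I_k -> R) :
  \sum_(i < k) c i * f i = 1 ->
  forall (N : 'I_k -> nat) (a : R), (forall i, f i ^+ N i * a = 0) -> a = 0.
Proof.
move=> cf N; have [s] := ubnP (\sum_i N i)%N.
elim: s N => // s IH N sN a fa; rewrite -[a]mul1r -cf mulr_suml big1 // => i _.
have [Ni|Ni] := posnP (N i).
  by have := fa i; rewrite Ni mul1r => ->; rewrite mulr0.
rewrite -mulrA (IH (fun j => (N j - (j == i))%N) _ (f i * a)) ?mulr0 //.
  move: sN; rewrite (bigD1 i) //= => sN; rewrite (bigD1 i) //= eqxx subn1.
  rewrite (eq_bigr N) => [|j /negPf ->]; last by rewrite subn0.
  by rewrite -ltnS -addSn prednK.
move=> j; have [->|_] := eqVneq j i; last by rewrite subn0 mulrCA fa mulr0.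
by rewrite subn1 mulrA -exprSr prednK.
Qed.

Lemma loc_of_eq0 (R : comPzRingType) (f a : R) :
  loc_of f a = 0 -> exists N, f ^+ N * a = 0.
Proof.
move/(proj2 (loc_eqP f (a, 0%N) (0, 0%N))) => [N] /=.
by rewrite !mulr1 mulr0; exists N.
Qed.

(** * Graphs of linear maps between coordinate subspaces *)

Section Chart.
Variables (n r : nat) (t : 'I_n -> bool).

(** If the quotient of R^n by a summand F of rank r is generated by the n - r
    basis vectors e_j with [~~ t j], these vectors form a basis of it. The
    quotient map, followed by the resulting lift to R^n, is a projector [P]
    that fixes these e_j, has its image in their span, and has kernel F. *)
Definition chart_projector (R : pzRingType) (P : 'M[R]_n) : Prop :=
  (forall k j, t k -> P k j = 0) /\
  (forall k j, ~~ t j -> P k j = (k == j)%:R).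

Definition kernel (R : pzRingType) (P : 'M[R]_n) : set 'cV[R]_n :=
  [set x | P *m x = 0]%classic.

Lemma chart_projector_map (R R' : pzRingType) (h : {rmorphism R -> R'})
    (P : 'M[R]_n) : chart_projector P -> chart_projector (map_mx h P).
Proof.
case=> P0 P1; split=> k j tt; rewrite mxE; first by rewrite P0 // rmorph0.
by rewrite P1 // rmorph_nat.
Qed.

(** [P] acts as the identity on its image, which is the span of the e_i with
    [~~ t i]. *)
Lemma chart_projector_absorb (R : pzRingType) (P : 'M[R]_n) k
    (M : 'M[R]_(n, k)) :
  chart_projector P -> (forall i j, t i -> M i j = 0) -> P *m M = M.
Proof.
move=> [P0 P1] M0; apply/matrixP => i j.
rewrite mxE (bigD1 i) //= big1 => [|l li].
  rewrite addr0; have [ti|ti] := boolP (t i); first by rewrite M0 // mulr0.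
  by rewrite P1 // eqxx mul1r.
have [tl|tl] := boolP (t l); first by rewrite M0 // mulr0.
by rewrite P1 // eq_sym (negPf li) mul0r.
Qed.

Lemma chart_projector_idem (R : pzRingType) (P : 'M[R]_n) :
  chart_projector P -> P *m (1%:M - P) = 0.
Proof.
by move=> cP; rewrite mulmxBr mulmx1 chart_projector_absorb ?subrr //; case: cP.
Qed.

Lemma kernel_submodule (R : comPzRingType) (P : 'M[R]_n) : submodule (kernel P).
Proof.
rewrite /kernel; split=> [|a x y /= hx hy] /=; first by rewrite mulmx0.
by rewrite mulmxDr -scalemxAr hx hy scaler0 addr0.
Qed.

Lemma kernel_range (R : pzRingType) (P : 'M[R]_n) :
  chart_projector P ->
  kernel P = range (fun c : 'cV[R]_n => (1%:M - P) *m c).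
Proof.
move=> cP; apply/seteqP; split=> x /=; rewrite /kernel /=.
  by move=> Px; exists x => //; rewrite mulmxBl Px mul1mx subr0.
by case=> c _ <-; rewrite mulmxA chart_projector_idem // mul0mx.
Qed.

(** The kernel is described here as the image of the complementary projector,
    since images, unlike kernels, commute with base change of the matrix. *)
Lemma kernel_base_change (R R' : comPzRingType) (h : {rmorphism R -> R'})
    (P : 'M[R]_n) : chart_projector P ->
  base_change h (kernel P) = kernel (map_mx h P).
Proof.
move=> cP; rewrite kernel_range // base_change_range.
rewrite (kernel_range (chart_projector_map h cP)).
by rewrite map_mxB map_mx1.
Qed.

(** Equality of the kernels gives P (1 - P') = 0, so P = P P'; and P P' = P'
    because both projectors have the same image. *)
Lemma kernel_inj (R : pzRingType) (P P' : 'M[R]_n) :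
  chart_projector P -> chart_projector P' -> kernel P = kernel P' -> P = P'.
Proof.
move=> cP cP' eK; have P0 : P *m (1%:M - P') = 0.
  apply/matrixP => i j.
  have : kernel P (col j (1%:M - P')).
    by rewrite eK /kernel /= colE mulmxA chart_projector_idem // mul0mx.
  by rewrite /kernel /= colE mulmxA -colE => /matrixP/(_ i 0); rewrite !mxE.
move/eqP: P0; rewrite mulmxBr mulmx1 subr_eq0 => /eqP ->.
by apply: chart_projector_absorb => //; case: cP'.
Qed.

Hypothesis card_t : #|[pred j | t j]| = r.

Lemma kernel_locally_free_summand (R : comPzRingType) (P : 'M[R]_n) :
  chart_projector P -> locally_free_summand r (kernel P).
Proof.
move=> cP; have [f [f_inj f_im]] := enumerate card_t.
have tf a : t (f a) by have := f_im (f a); rewrite codom_f inE => /esym.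
pose V := colsub f (1%:M - P); pose C : 'M[R]_(r, n) := rowsub f 1%:M.
have CV : C *m V = 1%:M.
  rewrite -mxsub_mul mul1mx; apply/matrixP => a b; rewrite !mxE.
  by rewrite cP.1 // subr0 (inj_eq f_inj).
have KE : kernel P = range (fun c : 'cV[R]_r => V *m c).
  apply/seteqP; split=> x; last first.
    case=> c _ <-.
    rewrite /kernel /= mulmxA mulmx_colsub chart_projector_idem //.
    apply/matrixP => i j; rewrite mxE [RHS]mxE big1 // => a _.
    by rewrite !mxE mul0r.
  rewrite /kernel /= => Px; exists (C *m x) => //.
  transitivity ((1%:M - P) *m x); last by rewrite mulmxBl Px mul1mx subr0.
  apply/matrixP => i j; rewrite !mxE [RHS](sum_codom f_inj) => [|k].
    apply: eq_bigr => a _.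
    by rewrite -rowsubE !mxE.
  by rewrite f_im inE => tk; rewrite !mxE cP.2 // subrr mul0r.
split; first exact: kernel_submodule.
exists 1%N, (fun=> 1); split.
  by exists (fun=> 1); rewrite big_ord1 mulr1.
move=> i; apply/free_summandP; first exact: submodule_base_change.
exists (map_mx (loc_of 1) V), (map_mx (loc_of 1) C).
by rewrite -map_mxM CV map_mx1 KE base_change_range.
Qed.

(** The generators e_k, [~~ t k], of the quotient are linearly independent.
    Locally F is the image of a matrix V with r columns. Every e_b with [t b]
    is congruent modulo F to a combination of the generators, which says that
    the square submatrix V_t of V with rows in [t] has a right inverse, hence
    is invertible. An element V a of F supported outside [t] satisfies V_t a =
    0, so a = 0. *)
Lemma supported_eq0 (R : comPzRingType) (F : set 'cV[R]_n) (x : 'cV[R]_n) :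
  locally_free_summand r F ->
  (forall x : 'cV[R]_n, exists c : 'I_n -> R,
    F (x - \sum_(j | ~~ t j) c j *: evec j)) ->
  F x -> (forall k, t k -> x k 0 = 0) -> x = 0.
Proof.
move=> [sF [l [f [[c cf] hF]]]] gF Fx x0.
have [T [T_inj T_im]] := enumerate card_t.
have tT a : t (T a) by have := T_im (T a); rewrite codom_f inE => /esym.
suff loc0 q k : exists N, f q ^+ N * x k 0 = 0.
  apply/matrixP => k j; rewrite (ord1 j) mxE.
  have [N hN] := choice (fun q => loc0 q k).
  exact: (cover_torsion cf) hN.
apply: loc_of_eq0.
have [[V [_ VE]] _] := hF q.
have inV y : F y -> exists a, V *m a = map_mx (loc_of (f q)) y.
  move=> Fy; have := @base_change_in _ _ (loc_of (f q)) _ _ _ Fy; rewrite VE.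
  by case=> a _ <-; exists a.
have [a Va] := inV x Fx.
have hB b : exists y : 'cV_r, rowsub T (V *m y) = delta_mx b 0.
  have [d Fd] := gF (evec (T b)); have [y Vy] := inV _ Fd.
  exists y; rewrite Vy; apply/matrixP => b' j; rewrite (ord1 j) !mxE summxE.
  rewrite big1 => [|i ti].
    by rewrite subr0 rmorph_nat (inj_eq T_inj).
  rewrite !mxE; case: eqP ti => [<-|_ _]; first by rewrite tT.
  by rewrite mulr0.
have [y hy] := choice hB.
pose B := \matrix_(i, b) y b i 0.
have VB : rowsub T V *m B = 1%:M.
  apply/matrixP => b' b.
  have /matrixP/(_ b' 0) := hy b; rewrite !mxE andbT => <-.
  by apply: eq_bigr => i _; rewrite !mxE.
have a0 : a = 0.
  rewrite -[a]mul1mx -(mulmx1C VB) -mulmxA mul_rowsub_mx Va.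
  have -> : rowsub T (map_mx (loc_of (f q)) x) = 0; last by rewrite mulmx0.
  by apply/matrixP => b j; rewrite (ord1 j) !mxE x0 // rmorph0.
move: Va; rewrite a0 mulmx0 => /matrixP/(_ k 0).
by rewrite !mxE.
Qed.

(** The generation hypothesis, applied to the basis vectors, provides the
    columns of the projector globally; only independence has to be checked
    locally. *)
Lemma summand_kernel (R : comPzRingType) (F : set 'cV[R]_n) :
  locally_free_summand r F ->
  (forall x : 'cV[R]_n, exists c : 'I_n -> R,
    F (x - \sum_(j | ~~ t j) c j *: evec j)) ->
  exists P : 'M[R]_n, chart_projector P /\ F = kernel P.
Proof.
move=> lF gF; have [sF0 sF] := lF.1.
have [c hc] := choice (fun j => gF (evec j)).
pose P : 'M[R]_n :=
  \matrix_(k, j) if t j then if t k then 0 else c j k else (k == j)%:R.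
have cP : chart_projector P.
  split=> k j tt; rewrite mxE; last by rewrite (negPf tt).
  by case: ifP => tj; [rewrite tt | case: eqP tj tt => // -> ->].
have FP (x : 'cV[R]_n) : F (x - P *m x).
  have -> : x - P *m x = \sum_j x j 0 *: (evec j - P *m evec j).
    rewrite (eq_bigr (fun j => x j 0 *: evec j - P *m (x j 0 *: evec j))).
      rewrite sumrB -mulmx_sumr.
      have <- : x = \sum_j x j 0 *: evec j; last by [].
      apply/matrixP => i j; rewrite (ord1 j) summxE (bigD1 i) //= big1.
        by rewrite !mxE !eqxx mulr1 addr0.
      by move=> k /negPf ki; rewrite !mxE eq_sym ki mulr0.
    by move=> j _; rewrite scalerBr scalemxAr.
  elim/big_rec: _ => // j y _ Fy; apply: sF => //.
  rewrite /evec -colE; have [tj|tj] := boolP (t j).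
    have -> : col j P = \sum_(k | ~~ t k) c j k *: evec k; last exact: hc.
    apply/matrixP => i k; rewrite (ord1 k) !mxE tj summxE.
    case: ifP => ti; last first.
      rewrite (bigD1 i) ?ti //= big1 => [|l /andP[_ /negPf li]].
        by rewrite !mxE !eqxx mulr1 addr0.
      by rewrite !mxE eq_sym li mulr0.
    rewrite big1 // => l tl; rewrite !mxE.
    by case: eqP tl => [<-|_ _]; rewrite ?ti // mulr0.
  have -> : col j P = delta_mx j 0; last by rewrite subrr.
  by apply/matrixP => i k; rewrite (ord1 k) !mxE (negPf tj) andbT.
exists P; split=> //; apply/seteqP; split=> x; rewrite /kernel /=; last first.
  by move=> Px; have := FP x; rewrite Px subr0.
move=> Fx; apply: (supported_eq0 lF gF).
  have -> : P *m x = (-1) *: (x - P *m x) + x; last exact: sF.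
  by rewrite scaleN1r opprB subrK.
by move=> k tk; rewrite mxE big1 // => j _; rewrite cP.1 // mul0r.
Qed.

End Chart.

(** * The chart as a functor of projectors *)

Section Projectors.
Variables (O : comPzRingType) (m n r : nat) (phi : 'I_m -> 'M[O]_n).
Variable t : 'I_m -> 'I_n -> bool.
Implicit Types A B : o_algebra O.

(** The compatibility of the subspaces says that phi_i maps the kernel of P_i,
    which is the image of 1 - P_i, into the kernel of P_(i+1). *)
Definition projector_family A (P : matrix_families O m n A) : Prop :=
  (forall i, chart_projector (t i) (P i)) /\
  forall i, P (ordS i) *m map_mx (oalg_str A) (phi i) =
            P (ordS i) *m map_mx (oalg_str A) (phi i) *m P i.

Lemma map_o_hom A B (h : o_hom A B) (M : 'M[O]_n) :
  map_mx h (map_mx (oalg_str A) M) = map_mx (oalg_str B) M.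
Proof. by apply/matrixP => a b; rewrite !mxE o_hom_str. Qed.

Lemma projector_family_stable A B (h : o_hom A B)
    (P : matrix_families O m n A) :
  projector_family P -> projector_family (Defs.pmap h P).
Proof.
case=> cP compat; split=> i; first exact: chart_projector_map.
by rewrite -(map_o_hom h) -!map_mxM {1}compat.
Qed.

Definition projectors : o_functor O := subfunctor projector_family_stable.

Hypothesis card_t : forall i, #|[pred j | t i j]| = r.

Lemma kernel_compatible A (P : 'I_m -> 'M[A]_n) :
  (forall i, chart_projector (t i) (P i)) ->
  (forall i x, kernel (P i) x ->
     kernel (P (ordS i)) (map_mx (oalg_str A) (phi i) *m x)) <->
  (forall i, P (ordS i) *m map_mx (oalg_str A) (phi i) =
            P (ordS i) *m map_mx (oalg_str A) (phi i) *m P i).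
Proof.
move=> cP; split=> H i; last first.
  move=> x; rewrite /kernel /= => Px.
  by rewrite mulmxA H -(mulmxA _ (P i)) Px mulmx0.
have : P (ordS i) *m map_mx (oalg_str A) (phi i) *m (1%:M - P i) = 0;
  last first.
  by move/eqP; rewrite mulmxBr mulmx1 subr_eq0 => /eqP.
apply/matrixP => a b; have := H i (col b (1%:M - P i)).
rewrite /kernel /= !colE !mulmxA (chart_projector_idem (cP i)) mul0mx.
by move=> /(_ erefl); rewrite -colE => /matrixP/(_ a 0); rewrite !mxE.
Qed.

Lemma kernel_compatible_family A (P : projectors A) :
  compatible_family r phi (fun i => kernel (sval P i)).
Proof.
case: P => P [cP compat] /=; split=> i.
  exact: kernel_locally_free_summand.
by move: i; apply/kernel_compatible.
Qed.

Lemma kernel_quotients_generated A (P : projectors A) :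
  @quotients_generated O m n r phi t A
    (exist _ (fun i => kernel (sval P i)) (kernel_compatible_family P)).
Proof.
case: P => P [cP compat] i x /=; exists (fun j => (P i *m x) j 0).
have -> : \sum_(j | ~~ t i j) (P i *m x) j 0 *: evec j = P i *m x.
  apply/matrixP => a b; rewrite (ord1 b) summxE.
  have [ta|ta] := boolP (t i a).
    rewrite big1 => [|j tj].
      by rewrite mxE big1 // => j _; rewrite (cP i).1 ?mul0r.
    by rewrite !mxE; case: eqP tj => [<-|_ _]; rewrite ?ta // mulr0.
  rewrite (bigD1 a) //= big1 => [|j /andP[_ /negPf ja]].
    by rewrite [evec]lock !mxE -lock !mxE !eqxx mulr1 addr0.
  by rewrite [evec]lock !mxE -lock !mxE eq_sym ja mulr0.
rewrite /kernel /= mulmxBr mulmxA.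
by rewrite (chart_projector_absorb (cP i) (cP i).1) subrr.
Qed.

Definition kernel_family A (P : projectors A) : scheme_U r phi t A :=
  exist _ _ (kernel_quotients_generated P).

(** A projector is determined by its kernel, every point of the chart arises
    from projectors, and forming the kernel commutes with base change. *)
Lemma projectors_isomorphic : isomorphic projectors (scheme_U r phi t).
Proof.
apply: (@isomorphic_of_inj_surj _ _ _ kernel_family) => [A|A [[F [lF cF]] gF]|].
- move=> [P [cP hP]] [P' [cP' hP']] /(congr1 (fun F => sval (sval F))) /= e.
  apply: eq_exist; apply/funext => i; apply: kernel_inj (cP i) (cP' i) _.
  exact: (congr1 (fun F => F i) e).
- have ex i := summand_kernel (card_t i) (lF i) (gF i).
  have [P hP] := choice ex.
  have FE : F = (fun i => kernel (P i)) by apply/funext => i; case: (hP i).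
  have pP : projector_family (P : matrix_families O m n A).
    split=> [i|]; first by case: (hP i).
    apply/kernel_compatible => [i|i x]; first by case: (hP i).
    by have := cF i x; rewrite FE.
  exists (exist _ (P : matrix_families O m n A) pP).
  by apply: eq_exist; apply: eq_exist; rewrite FE.
- move=> A B h [P [cP hP]]; apply: eq_exist; apply: eq_exist.
  by apply/funext => i /=; rewrite (kernel_base_change h (cP i)).
Qed.

End Projectors.

(** * Coordinates on families of projectors *)

Section Coordinates.
Variables (m n k : nat) (t : 'I_m -> 'I_n -> bool) (c : 'I_n -> 'I_m).
Variable js : 'I_m -> 'I_k -> 'I_n.
(* [c j] stands for the transition at which e_j is multiplied by the
   uniformizer, the only one at which t_i(j) may drop from 1 to 0. *)
Hypothesis t_drop : forall i j, t i j -> ~~ t (ordS i) j -> i = c j.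
Hypothesis hjs : enumeration t js.

Lemma always0N i j : j \in always0 t -> t i j = false.
Proof. by move=> /forallP/(_ i)/negPf. Qed.

Lemma js_inj i : injective (js i).
Proof. by case: (hjs i). Qed.

Lemma js_t i a : t i (js i a) = false.
Proof.
by have := (hjs i).2 (js i a); rewrite codom_f inE => /esym/andP[_ /negPf].
Qed.

Lemma js_always0 i a : js i a \in always0 t = false.
Proof.
by have := (hjs i).2 (js i a); rewrite codom_f inE => /esym/andP[/negPf].
Qed.

Variant index_spec i x : Type :=
  | IndexOne of t i x
  | IndexAlways0 of x \in always0 t
  | IndexJs a of x = js i a.

Lemma indexP i x : index_spec i x.
Proof.
have [tx|tx] := boolP (t i x); first exact: IndexOne.
have [x0|x0] := boolP (x \in always0 t); first exact: IndexAlways0.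
have /codomP/cid[a xa] : x \in codom (js i) by rewrite (hjs i).2 inE x0 tx.
exact: IndexJs xa.
Qed.

(** Once [j] is in [t], it can leave only at the transition [c j], so being
    in [t] right after that transition means never leaving. *)
Lemma t_start_always1 j : t (ordS (c j)) j -> j \in always1 t.
Proof.
move=> tj; apply/forallP; apply: (cycle_ind (c := c j)) => // i ic ti.
by apply: contraNT ic => /(t_drop ti) ->.
Qed.

Section Ring.
Variables (A : comPzRingType) (p : A).

Definition diag_coef i j : A := if i == c j then p else 1.
(** The matrix of phi_i over A, with [p] the image of the uniformizer. *)
Definition diag_map i : 'M[A]_n := diag_mx (\row_j diag_coef i j).

Lemma mul_diag_map q (M : 'M[A]_(q, n)) i x j :
  (M *m diag_map i) x j = M x j * diag_coef i j.
Proof. by rewrite mul_mx_diag !mxE. Qed.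

(** A chain picks up the factor [p] in position [j] exactly when it crosses the
    transition [c j]. *)
Lemma chain_diag_map i l : (l <= m)%N ->
  chain diag_map i l =
  diag_mx (\row_j (if (cdist i (c j) < l)%N then p else 1)).
Proof.
elim: l i => [|l IH] i lm /=.
  by apply/matrixP => x j; rewrite !mxE.
rewrite IH 1?ltnW // mulmx_diag; congr diag_mx; apply/rowP => j.
rewrite !mxE /diag_coef.
case: eqP => [->|/eqP ic]; last by rewrite mulr1 (cdistSl ic) ltnS.
rewrite cdistii ifF ?mul1r //.
by apply/negbTE; rewrite -leqNgt -ltnS cdist_last.
Qed.

Lemma chain_diag_map_full i : chain diag_map i m = p%:M.
Proof.
rewrite chain_diag_map // -diag_const_mx; congr diag_mx.
by apply/rowP => j; rewrite !mxE ltn_cdist.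
Qed.

(** The image of P lies in the span of the e_y with t_i(y) = 0, and these
    indices y are those in S_0 together with those enumerated by [js i]. *)
Lemma mul_chart q (M : 'M[A]_(q, n)) (P : 'M[A]_n) i x j :
  (forall y, t i y -> P y j = 0) ->
  (M *m P) x j = \sum_(y in always0 t) M x y * P y j
               + (colsub (js i) M *m rowsub (js i) P) x j.
Proof.
move=> P0; rewrite mxE (bigID [in always0 t]) /=; congr (_ + _).
rewrite big_mkcond (sum_codom (@js_inj i)) /= => [|y].
  by rewrite mxE; apply: eq_bigr => a _; rewrite js_always0 !mxE.
case: (indexP i y) => [ty _|-> //|a ->]; last by rewrite codom_f.
by rewrite P0 // mulr0 if_same.
Qed.

(** The map induced by phi_i on the quotients by the subspaces and by the e_y
    with y in S_0, in the bases enumerated by [js]; the point of W attached to a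
    family of projectors consists of these matrices. *)
Definition quot_map (P : 'I_m -> 'M[A]_n) i : 'M[A]_k :=
  colsub (js i) (rowsub (js (ordS i)) (P (ordS i)) *m diag_map i).

Definition compatible (P : 'I_m -> 'M[A]_n) : Prop :=
  forall i, P (ordS i) *m diag_map i = P (ordS i) *m diag_map i *m P i.

Section OneFamily.
Variable P : 'I_m -> 'M[A]_n.
Hypothesis cP : forall i, chart_projector (t i) (P i).
Hypothesis compat : compatible P.

(** The rows of P_i enumerated by [js i] are the projection to the i-th
    quotient, so this is the commutation of the projections with phi_i and the
    map that it induces. It determines column j at i+1 from column j at i,
    except at the transition [c j]. *)
Lemma quot_map_rows i :
  rowsub (js (ordS i)) (P (ordS i)) *m diag_map i =
  quot_map P i *m rowsub (js i) (P i).
Proof.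
apply/matrixP => a j; rewrite mul_rowsub_mx compat -mulmxA -mul_rowsub_mx.
rewrite mulmxA (@mul_chart _ _ _ i) => [|y ty]; last by rewrite (cP i).1.
rewrite big1 ?add0r // => y y0; rewrite mul_diag_map mxE (cP _).2 ?always0N //.
by case: eqP y0 => [<-|_ _]; rewrite ?js_always0 // !mul0r.
Qed.

Lemma rowsub_projector_id i : colsub (js i) (rowsub (js i) (P i)) = 1%:M.
Proof.
by apply/matrixP => a b; rewrite !mxE (cP i).2 ?js_t // (inj_eq (@js_inj i)).
Qed.

(** Iterating [quot_map_rows]: the composite around the whole cycle induces
    multiplication by [p] on the quotient, since the phi_i compose to [p]. *)
Lemma quot_chain i l :
  chain (quot_map P) i l *m rowsub (js i) (P i) =
  rowsub (js (iter l (@ordS m) i)) (P (iter l (@ordS m) i))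
    *m chain diag_map i l.
Proof.
elim: l i => [|l IH] i; first by rewrite mul1mx mulmx1.
by rewrite iterSr [LHS]/= -mulmxA -quot_map_rows mulmxA IH -mulmxA.
Qed.

Lemma quot_cycle i : chain (quot_map P) i m = p%:M.
Proof.
have := quot_chain i m.
rewrite iter_ordS_period chain_diag_map_full mul_mx_scalar.
move=> /(congr1 (fun M => M *m colsub (js i) 1%:M)).
rewrite -scalemxAl -mulmxA mulmx_colsub mulmx1 rowsub_projector_id.
by rewrite mulmx1 scalemx1.
Qed.

Lemma quot_map_fixed i a b : js i a = js (ordS i) b ->
  forall x, quot_map P i x a = diag_coef i (js i a) * (x == b)%:R.
Proof.
move=> ab x; rewrite mxE mul_diag_map mxE mulrC; congr (_ * _).
by rewrite (cP _).2 ab ?js_t // (inj_eq (@js_inj _)).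
Qed.

(** The same compatibility in a row y of S_0.  It determines row y at i from
    row y at i+1, except at the transition [c y]. *)
Lemma always0_rows i y j : y \in always0 t ->
  (row y (P (ordS i)) *m diag_map i) 0 j = diag_coef i y * P i y j +
  (colsub (js i) (row y (P (ordS i)) *m diag_map i) *m rowsub (js i) (P i)) 0 j.
Proof.
move=> y0; have /rowP/(_ j) := congr1 (row y) (compat i).
rewrite !row_mul => ->.
rewrite (@mul_chart _ _ _ i) => [|x tx]; last by rewrite (cP i).1.
rewrite (bigD1 y) //= big1 ?addr0 => [|x /andP[x0 xy]].
  by rewrite mul_diag_map mxE (cP _).2 ?always0N // eqxx mul1r.
by rewrite mul_diag_map mxE (cP _).2 ?always0N // eq_sym (negPf xy) !mul0r.
Qed.

End OneFamily.

(** Column j of the projection to the quotient is propagated forward from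
    [ordS (c j)], where it is free if t_i(j) = 1 for all i and is otherwise a
    basis vector or zero.  A row y of S_0 is propagated backward from [c y]. *)
Lemma coordinates_inj (P P' : 'I_m -> 'M[A]_n) :
  (forall i, chart_projector (t i) (P i)) ->
  compatible P ->
  (forall i, chart_projector (t i) (P' i)) ->
  compatible P' ->
  quot_map P =1 quot_map P' ->
  (forall j a, j \in always1 t ->
     P (ordS (c j)) (js (ordS (c j)) a) j =
     P' (ordS (c j)) (js (ordS (c j)) a) j) ->
  (forall y j, y \in always0 t -> t (c y) j -> P (c y) y j = P' (c y) y j) ->
  P =1 P'.
Proof.
move=> cP hP cP' hP' eX eC eR.
have eRows i : rowsub (js i) (P i) = rowsub (js i) (P' i).
  apply/matrixP => a j; move: i a.
  apply: (cycle_ind (c := c j)) => [a|i ic IH a].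
    rewrite !mxE; have [tj|tj] := boolP (t (ordS (c j)) j).
      exact: eC (t_start_always1 tj).
    by rewrite (cP _).2 // (cP' _).2.
  have col_eq (Q : 'I_m -> 'M[A]_n) :
      (forall i, chart_projector (t i) (Q i)) -> compatible Q ->
      rowsub (js (ordS i)) (Q (ordS i)) a j =
      (quot_map Q i *m rowsub (js i) (Q i)) a j.
    move=> cQ hQ; rewrite -quot_map_rows // mul_diag_map /diag_coef.
    by rewrite (negPf ic) mulr1.
  rewrite !col_eq // eX !mxE; apply: eq_bigr => b _; congr (_ * _).
  exact: IH.
have eS y : y \in always0 t -> forall i, row y (P i) = row y (P' i).
  move=> y0; apply: (cycle_ind_back (c := c y)) => [|i ic IH]; apply/rowP => j.
    rewrite !mxE; have [tj|tj] := boolP (t (c y) j); first exact: eR.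
    by rewrite (cP _).2 // (cP' _).2.
  have := always0_rows cP hP i j y0; have := always0_rows cP' hP' i j y0.
  rewrite /diag_coef (negPf ic) !mul1r -IH -eRows => -> /addIr.
  by rewrite !mxE.
move=> i; apply/matrixP => x j; case: (indexP i x) => [tx|x0|a ->].
- by rewrite (cP i).1 // (cP' i).1.
- by have /rowP/(_ j) := eS x x0 i; rewrite !mxE.
- by have /matrixP/(_ a j) := eRows i; rewrite !mxE.
Qed.

Section Reconstruction.
Variables (X : 'I_m -> 'M[A]_k) (v : 'I_n -> 'cV[A]_k) (w : 'I_n -> 'rV[A]_n).
Hypothesis X_fixed : forall i a b, ~~ t (ordS i) (js i a) ->
  js i a = js (ordS i) b ->
  forall x, X i x a = diag_coef i (js i a) * (x == b)%:R.
Hypothesis X_cycle : forall i, chain X i m = p%:M.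

(** The indicator column is the basis vector at j, unless j is in S_0, where it
    is zero. *)
Definition start_col j : 'cV[A]_k :=
  if j \in always1 t then v j else \col_a (js (ordS (c j)) a == j)%:R.

(** The projections to the quotients rebuilt from the induced maps [X], each
    column being propagated forward from [ordS (c j)]. *)
Definition quot_rows i : 'M[A]_(k, n) :=
  \matrix_(a, j)
    (chain X (ordS (c j)) (cdist (ordS (c j)) i) *m start_col j) a 0.

Lemma col_quot_rows j i :
  col j (quot_rows i) =
  chain X (ordS (c j)) (cdist (ordS (c j)) i) *m start_col j.
Proof. by apply/matrixP => a b; rewrite (ord1 b) !mxE. Qed.

Lemma quot_rows_start j : col j (quot_rows (ordS (c j))) = start_col j.
Proof. by rewrite col_quot_rows cdistii mul1mx. Qed.

(** At the transition [c j] the propagation has gone once around the cycle, and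
    it closes up because the cyclic product of the [X] is [p]. *)
Lemma quot_rows_col_step i j :
  X i *m col j (quot_rows i) = diag_coef i j *: col j (quot_rows (ordS i)).
Proof.
rewrite !col_quot_rows mulmxA -{1}(iter_cdist (ordS (c j)) i) -chainSr.
rewrite /diag_coef.
case: eqP => [->|/eqP ic].
  by rewrite cdist_last X_cycle cdistii mul_scalar_mx mul1mx.
by rewrite scale1r cdist_ordS [in RHS]cdistSl // eq_sym.
Qed.

Lemma quot_rows_step i : quot_rows (ordS i) *m diag_map i = X i *m quot_rows i.
Proof.
apply/matrixP => a j; have /colP/(_ a) := quot_rows_col_step i j.
rewrite mul_diag_map colE mulmxA -colE [LHS]mxE => ->.
by rewrite [LHS]mulrC [RHS]mxE; congr (_ * _); rewrite !mxE.
Qed.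

Lemma quot_rows_always0 i a j : j \in always0 t -> quot_rows i a j = 0.
Proof.
move=> j0; rewrite mxE; have -> : start_col j = 0; last by rewrite mulmx0 mxE.
rewrite /start_col ifF.
  apply/colP => b; rewrite !mxE; case: eqP j0 => // <-.
  by rewrite js_always0.
by apply/negP => /forallP/(_ (c j)); rewrite always0N.
Qed.

(** If t_i(j) = 0 right after the transition [c j], column j starts as a basis
    vector.  If t_(i+1)(j) = 0 at a later i+1, then t_i(j) = 0 too, since t(j)
    drops only at [c j]; so the column is already a basis vector at i, and the
    prescribed column of [X] moves it to a basis vector at i+1. *)
Lemma quot_rows_js i : colsub (js i) (quot_rows i) = 1%:M.
Proof.
suff H j : forall a b, j = js i b -> quot_rows i a j = (a == b)%:R.
  by apply/matrixP => a b; rewrite mxE (H (js i b) a b) // mxE.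
move: i; apply: (cycle_ind (c := c j)) => [a b jb|i ic IH a b jb].
  have /colP/(_ a) := quot_rows_start j; rewrite mxE => ->.
  rewrite /start_col ifF; first by rewrite mxE {2}jb (inj_eq (@js_inj _)).
  by apply/negP => /forallP/(_ (ordS (c j))); rewrite {2}jb js_t.
have tj : ~~ t i j.
  by apply: contraNN ic => ti; rewrite (t_drop ti) // jb js_t.
case: (indexP i j) => [|j0|b' jb']; first by rewrite (negPf tj).
  by move: j0; rewrite jb js_always0.
have /colP/(_ a) := quot_rows_col_step i j.
rewrite /diag_coef (negPf ic) scale1r [RHS]mxE => <-.
rewrite mxE (bigD1 b') //= big1.
  rewrite addr0 mxE (IH _ _ jb') eqxx mulr1 (X_fixed (b := b)) -?jb' //.
    by rewrite /diag_coef (negPf ic) mul1r.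
  by rewrite jb js_t.
by move=> d /negPf db'; rewrite mxE (IH _ _ jb') db' mulr0.
Qed.

Definition incl i : 'M[A]_(n, k) := colsub (js i) 1%:M.
(** The projector onto the kernel of [quot_rows i] along the span of the e_y
    with y enumerated by [js i]. *)
Definition kernel_proj i : 'M[A]_n := 1%:M - incl i *m quot_rows i.

Lemma quot_rows_incl i : quot_rows i *m incl i = 1%:M.
Proof. by rewrite mulmx_colsub mulmx1 quot_rows_js. Qed.

Lemma kernel_proj_incl i : kernel_proj i *m incl i = 0.
Proof. by rewrite mulmxBl mul1mx -mulmxA quot_rows_incl mulmx1 subrr. Qed.

(** phi_i maps the kernel of [quot_rows i] into that of [quot_rows (ordS i)],
    because composing it with [quot_rows (ordS i)] factors through
    [quot_rows i]. *)
Lemma kernel_proj_step i :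
  kernel_proj (ordS i) *m diag_map i *m kernel_proj i =
  diag_map i *m kernel_proj i.
Proof.
have R0 : quot_rows i *m kernel_proj i = 0.
  by rewrite mulmxBr mulmx1 mulmxA quot_rows_incl mul1mx subrr.
rewrite [kernel_proj (ordS i)]/kernel_proj !mulmxBl mul1mx.
rewrite -!(mulmxA (incl _)) quot_rows_step.
by rewrite -(mulmxA (X i)) R0 !mulmx0 subr0.
Qed.

Definition start_row y : 'rV[A]_n :=
  \row_j if t (c y) j then w y 0 j else (j == y)%:R.

(** The functional with which row y defines the i-th subspace inside the kernel
    of [quot_rows i]: the pullback of a functional chosen at [c y] along the
    maps phi from i to [c y]. *)
Definition always0_row i y : 'rV[A]_n :=
  start_row y *m chain diag_map i (cdist i (c y)) *m kernel_proj i.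

Lemma start_row_incl y : y \in always0 t -> start_row y *m incl (c y) = 0.
Proof.
move=> y0; rewrite mulmx_colsub mulmx1; apply/rowP => a; rewrite !mxE js_t.
by case: eqP y0 => // <-; rewrite js_always0.
Qed.

Lemma always0_row_start y :
  y \in always0 t -> always0_row (c y) y = start_row y.
Proof.
move=> y0; rewrite /always0_row cdistii mulmx1 mulmxBr mulmx1.
by rewrite mulmxA start_row_incl // mul0mx subr0.
Qed.

(** By [kernel_proj_step] the intermediate projectors disappear from the
    composites, so at [c y] the chain is the full product of the phi, which
    is [p]. *)
Lemma always0_row_step i y : y \in always0 t ->
  always0_row (ordS i) y *m diag_map i *m kernel_proj i =
  diag_coef i y *: always0_row i y.
Proof.
move=> y0; rewrite {1}/always0_row -(mulmxA _ (kernel_proj _)).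
rewrite -(mulmxA _ (_ *m diag_map i)) kernel_proj_step !mulmxA.
rewrite -(mulmxA (start_row y)).
rewrite -[chain _ _ _ *m diag_map i]/(chain diag_map i _.+1) /diag_coef.
case: eqP => [->|/eqP iy]; last by rewrite scale1r -cdistSl.
rewrite cdist_last chain_diag_map_full mul_mx_scalar -scalemxAl.
by rewrite /always0_row cdistii mulmx1.
Qed.

Lemma always0_row_chart i y j : y \in always0 t -> ~~ t i j ->
  always0_row i y 0 j = (y == j)%:R.
Proof.
move=> y0; case: (indexP i j) => [->//|j0 _|a -> _]; last first.
  transitivity ((always0_row i y *m incl i) 0 a).
    by rewrite mulmx_colsub mulmx1 [RHS]mxE.
  rewrite -mulmxA kernel_proj_incl mulmx0 mxE.
  by case: eqP y0 => // ->; rewrite js_always0.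
rewrite /always0_row mulmxBr mulmx1 mxE [X in _ + X]mxE mulmxA.
rewrite [X in _ - X]mxE big1 ?subr0 => [|a _]; last first.
  by rewrite quot_rows_always0 // mulr0.
rewrite chain_diag_map 1?ltnW ?ltn_cdist // mul_mx_diag !mxE always0N //.
by rewrite eq_sym; case: eqP => [->|_]; rewrite ?ltnn ?mul0r ?mulr1.
Qed.

Definition reconstruction i : 'M[A]_n :=
  \matrix_(x, j) if x \in always0 t then always0_row i x 0 j
                 else (incl i *m quot_rows i) x j.

Lemma row_reconstruction i y :
  y \in always0 t -> row y (reconstruction i) = always0_row i y.
Proof. by move=> y0; apply/rowP => j; rewrite !mxE y0. Qed.

Lemma rowsub_reconstruction i : rowsub (js i) (reconstruction i) = quot_rows i.
Proof.
transitivity (rowsub (js i) (incl i *m quot_rows i)).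
  by apply/matrixP => a j; rewrite 2!mxE js_always0 [RHS]mxE.
rewrite -mul_rowsub_mx -[RHS]mul1mx; congr (_ *m _).
by apply/matrixP => a b; rewrite !mxE (inj_eq (@js_inj _)).
Qed.

Lemma incl_quot_rows_out i x j :
  x \notin codom (js i) -> (incl i *m quot_rows i) x j = 0.
Proof.
move=> xi; rewrite mxE big1 // => a _; rewrite !mxE.
by case: eqP xi => [->|_ _]; rewrite ?codom_f // mul0r.
Qed.

Lemma reconstruction_chart i : chart_projector (t i) (reconstruction i).
Proof.
split=> x j tt; rewrite mxE.
  rewrite ifF; last by apply: contraTF tt => /always0N ->.
  apply: incl_quot_rows_out.
  by apply: contraTN tt => /codomP[a ->]; rewrite js_t.
case: ifP => x0; first exact: always0_row_chart.
case: (indexP i j) => [|j0|a ->]; first by rewrite (negPf tt).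
  rewrite mxE big1 => [|b _]; last by rewrite quot_rows_always0 // mulr0.
  by case: eqP x0 => // ->; rewrite j0.
transitivity ((incl i *m quot_rows i *m incl i) x a).
  by rewrite mulmx_colsub mulmx1 [RHS]mxE.
by rewrite -mulmxA quot_rows_incl mulmx1 !mxE.
Qed.

Lemma reconstruction_compat : compatible reconstruction.
Proof.
move=> i; have fi0 y j : t i y -> reconstruction i y j = 0.
  exact: (reconstruction_chart i).1.
apply/matrixP => x j; case: (indexP (ordS i) x) => [tx|x0|a ->].
- rewrite [RHS]mxE big1 => [|y _];
    by rewrite mul_diag_map (reconstruction_chart _).1 ?mul0r.
- have rowE q (M : 'M[A]_(n, q)) b : M x b = row x M 0 b by rewrite mxE.
  rewrite !rowE !row_mul row_reconstruction //.
  rewrite [RHS](@mul_chart _ _ _ i); last by move=> ?; exact: fi0.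
  rewrite rowsub_reconstruction (bigD1 x) //= big1 ?addr0 => [|y /andP[y0 yx]].
    rewrite [X in _ = X * _ + _]mul_diag_map always0_row_chart ?always0N //.
    rewrite eqxx mul1r [reconstruction i x j]mxE x0.
    have /rowP/(_ j) := always0_row_step i x0; rewrite [RHS]mxE => <-.
    rewrite mulmxBr mulmx1 mulmxA mulmx_colsub mulmx1.
    by rewrite [X in _ = X + _]mxE [in X in _ = _ + X + _]mxE subrK.
  rewrite mul_diag_map always0_row_chart ?always0N //.
  by rewrite eq_sym (negPf yx) !mul0r.
- have rowE q (M : 'M[A]_(n, q)) b :
    M (js (ordS i) a) b = rowsub (js (ordS i)) M a b by rewrite mxE.
  rewrite !rowE -!mul_rowsub_mx rowsub_reconstruction quot_rows_step.
  rewrite [RHS](@mul_chart _ _ _ i); last by move=> ?; exact: fi0.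
  rewrite rowsub_reconstruction -mulmx_colsub quot_rows_js mulmx1.
  rewrite big1 ?add0r // => y y0.
  by rewrite -quot_rows_step mul_diag_map quot_rows_always0 // !mul0r.
Qed.

Lemma reconstruction_quot_map i : quot_map reconstruction i = X i.
Proof.
rewrite /quot_map rowsub_reconstruction quot_rows_step.
by rewrite -mulmx_colsub quot_rows_js mulmx1.
Qed.

Lemma reconstruction_start_col j a : j \in always1 t ->
  reconstruction (ordS (c j)) (js (ordS (c j)) a) j = v j a 0.
Proof.
move=> j1; have /matrixP/(_ a j) := rowsub_reconstruction (ordS (c j)).
rewrite mxE => ->.
by have /colP/(_ a) := quot_rows_start j; rewrite mxE /start_col j1.
Qed.

Lemma reconstruction_start_row y j : y \in always0 t -> t (c y) j ->
  reconstruction (c y) y j = w y 0 j.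
Proof. by move=> y0 tj; rewrite mxE y0 always0_row_start // mxE tj. Qed.

End Reconstruction.
End Ring.
End Coordinates.

(** * The ramification indices of a generalized local model *)

Lemma diag_prod_entry (R : pzRingType) n (I : Type) (s : seq I)
    (M : I -> 'M[R]_n) j :
  (forall i, is_diag_mx (M i)) ->
  is_diag_mx (\prod_(i <- s) M i) /\
  (\prod_(i <- s) M i) j j = \prod_(i <- s) M i j j.
Proof.
move=> dM; elim: s => [|i s [dI eI]].
  by rewrite !big_nil; split; [exact: scalar_mx_is_diag | rewrite mxE eqxx].
rewrite !big_cons -eI; have /diag_mxP[d ->] := dM i.
have /diag_mxP[e ->] := dI.
rewrite -[_ * _]/(_ *m _) mulmx_diag; split; first exact: diag_mx_is_diag.
by rewrite !mxE eqxx.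
Qed.

(** For each j the diagonal entries at j have product [pi], and [pi] is neither
    a unit nor zero; so exactly one of them is [pi], the others are 1. *)
Lemma generalized_local_model_diag (O : idomainType) (pi : O) (m n : nat)
    (phi : 'I_m -> 'M[O]_n) :
  uniformizer pi -> generalized_local_model pi phi ->
  exists c : 'I_n -> 'I_m, phi = diag_map c pi.
Proof.
move=> [pi0 [_ pi1 _]] [phi_diag phi_val phi_prod].
have prod_j j : \prod_i phi i j j = pi.
  rewrite (reindex_inj rev_ord_inj) /=.
  have dphi i : is_diag_mx (phi (rev_ord i)) by [].
  have [_ <-] := diag_prod_entry (index_enum _) j dphi.
  by rewrite phi_prod mxE eqxx.
have ex j : exists c, forall i, phi i j j = if i == c then pi else 1.
  have [c cE] : exists c, phi c j j = pi.
    apply: contrapT => nc; apply: pi1; exists 1 => //.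
    rewrite mulr1 -(prod_j j).
    apply: big1 => i _; case: (phi_val i j) => // e.
    by case: nc; exists i.
  exists c => i; case: eqP => [->//|/eqP ic].
  case: (phi_val i j) => // e; case: pi1.
  exists (\prod_(l | (l != c) && (l != i)) phi l j j) => //.
  apply: (mulfI (x := pi)); first exact/eqP.
  rewrite mulr1 -[RHS](prod_j j) [RHS](bigD1 c) //=.
  by rewrite [X in _ = _ * X](bigD1 i) //= e cE.
have [c cE] := choice ex.
exists c; apply/funext => i; apply/matrixP => x j; rewrite !mxE /diag_coef.
have [->|xj] := eqVneq x j; first by rewrite cE mulr1n.
by rewrite mulr0n (is_diag_mxP (phi_diag i)).
Qed.

Lemma map_diag_map (R R' : comPzRingType) (h : {rmorphism R -> R'}) (p : R) m n
    (c : 'I_n -> 'I_m) i : map_mx h (diag_map c p i) = diag_map c (h p) i.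
Proof.
rewrite map_diag_mx; congr diag_mx; apply/rowP => j; rewrite !mxE /diag_coef.
by case: eqP; rewrite ?rmorph1.
Qed.

Lemma eps_diag_map (O : idomainType) (pi : O) m n (c : 'I_n -> 'I_m) i j :
  pi <> 1 -> eps (diag_map c pi) i j = (i == c j).
Proof.
move=> pi1; rewrite /eps.
have -> : diag_map c pi i *m evec j = diag_coef c pi i j *: evec j.
  apply/colP => x; rewrite mul_diag_mx !mxE.
  by case: eqP => [->|]; rewrite ?mulr0.
rewrite /diag_coef; case: (i =P c j) => [_|ic]; last by rewrite scale1r eqxx.
case: eqP => // /colP/(_ j); rewrite !mxE !eqxx mulr1.
by move=> e; case: pi1.
Qed.

(** * The coordinate isomorphism *)

Section CoordinateIsomorphism.
Variables (O : idomainType) (pi : O) (m n r k s t1 : nat).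
Variables (t : 'I_m -> 'I_n -> bool) (c : 'I_n -> 'I_m).
Variable js : 'I_m -> 'I_k -> 'I_n.
Hypothesis pi1 : pi <> 1.
Hypothesis t_drop : forall i j, t i j -> ~~ t (ordS i) j -> i = c j.
Hypothesis hjs : enumeration t js.
Variables (S0 : 'I_s -> 'I_n) (S1 : 'I_t1 -> 'I_n) (T : 'I_m -> 'I_r -> 'I_n).
Hypothesis S0_inj : injective S0.
Hypothesis S0_im : codom S0 =i always0 t.
Hypothesis S1_inj : injective S1.
Hypothesis S1_im : codom S1 =i always1 t.
Hypothesis T_inj : forall i, injective (T i).
Hypothesis T_im : forall i, codom (T i) =i [pred j | t i j].
Implicit Types A B : o_algebra O.

Let Pr := projectors (diag_map c pi) t.
Let W := scheme_W pi (diag_map c pi) t js.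

Lemma projector_compat A (P : Pr A) i :
  sval P (ordS i) *m diag_map c (oalg_str A pi) i =
  sval P (ordS i) *m diag_map c (oalg_str A pi) i *m sval P i.
Proof. by case: P => P [cP compat] /=; rewrite -map_diag_map. Qed.

Lemma in_W_iff A (X : matrix_families O m k A) :
  in_W pi (diag_map c pi) t js X <->
  (forall i a b, ~~ t (ordS i) (js i a) -> js i a = js (ordS i) b ->
     forall x, X i x a =
       diag_coef c (oalg_str A pi) i (js i a) * (x == b)%:R) /\
  (forall i, chain X i m = (oalg_str A pi)%:M).
Proof.
have coefE i j : diag_coef c (oalg_str A pi) i j =
    oalg_str A pi ^+ eps (diag_map c pi) i j.
  by rewrite eps_diag_map // /diag_coef; case: eqP.
split=> -[X1 X2]; split=> i; rewrite -?cyclic_productE //.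
- by move=> a b ta ab x; rewrite coefE; exact: X1.
- by move=> a b ta ab x; rewrite -coefE; exact: X1.
- by rewrite cyclic_productE.
Qed.

Lemma quot_map_in_W A (P : Pr A) :
  in_W pi (diag_map c pi) t js
    (quot_map c js (oalg_str A pi) (sval P) : matrix_families O m k A).
Proof.
have cP := (svalP P).1; have hP := projector_compat P.
apply/in_W_iff; split=> i; last exact: quot_cycle.
by move=> a b _ ab x; exact: quot_map_fixed.
Qed.

(** The affine coordinates: s rows with r entries, read at the transitions of
    the indices in S_0, and t1 columns with k = n - r - s entries, read right
    after the transitions of the indices j with t_i(j) = 1 for all i. *)
Definition free_rows A (P : 'I_m -> 'M[A]_n) : 'M[A]_(r, s) :=
  \matrix_(a, b) P (c (S0 b)) (S0 b) (T (c (S0 b)) a).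

Definition free_cols A (P : 'I_m -> 'M[A]_n) : 'M[A]_(t1, k) :=
  \matrix_(a, b) P (ordS (c (S1 a))) (js (ordS (c (S1 a))) b) (S1 a).

Definition coordinates A (P : Pr A) :
    product W (affine_space O (r * s + t1 * k)) A :=
  (exist _ _ (quot_map_in_W P),
   row_mx (mxvec (free_rows (sval P))) (mxvec (free_cols (sval P)))).

Lemma coordinates_isomorphic :
  isomorphic Pr (product W (affine_space O (r * s + t1 * k))).
Proof.
apply: (@isomorphic_of_inj_surj _ _ _ coordinates) => [A|A [[X XW] u]|A B h].
- move=> P P' e; suff eP : sval P = sval P'.
    by case: P P' {e} eP => [P pP] [P' pP']; exact: eq_exist.
  have eX : quot_map c js (oalg_str A pi) (sval P) =
            quot_map c js (oalg_str A pi) (sval P').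
    exact: (congr1 (fun y : W A * affine_space O _ A => sval y.1) e).
  have [eR eC] : free_rows (sval P) = free_rows (sval P') /\
                 free_cols (sval P) = free_cols (sval P').
    have /eq_row_mx[/(can_inj mxvecK) -> /(can_inj mxvecK) ->] :=
      congr1 snd e.
    by [].
  have cP := (svalP P).1; have hP := projector_compat P.
  have cP' := (svalP P').1; have hP' := projector_compat P'.
  apply/funext.
  apply: (coordinates_inj t_drop hjs cP hP cP' hP') => [i|j a|y j].
  + by rewrite eX.
  + rewrite -S1_im => /codomP[b ->].
    by move/matrixP/(_ b a): eC; rewrite !mxE.
  + rewrite -S0_im => /codomP[b ->] tj.
    have /codomP[a ->] : j \in codom (T (c (S0 b))) by rewrite T_im.
    by move/matrixP/(_ a b): eR; rewrite !mxE.
- have /in_W_iff[X_fixed X_cycle] := XW.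
  pose M1 : 'M[A]_(r, s) := vec_mx (lsubmx u).
  pose M2 : 'M[A]_(t1, k) := vec_mx (rsubmx u).
  have [v vE] := extend_along (fun a => \col_b M2 a b) 0 S1_inj.
  have [q qE] :=
    choice (fun b => extend_along (fun a => M1 a b) 0 (@T_inj (c (S0 b)))).
  have [w wE] := extend_along (fun b => \row_j q b j) 0 S0_inj.
  pose P := reconstruction t c js (oalg_str A pi) X v w.
  have pP : projector_family (diag_map c pi) t (P : matrix_families O m n A).
    split=> i.
      exact: (reconstruction_chart t_drop hjs v w X_fixed X_cycle).
    rewrite map_diag_map.
    exact: (reconstruction_compat t_drop hjs v w X_fixed X_cycle).
  exists (exist _ (P : matrix_families O m n A) pP).
  rewrite /coordinates; congr pair.
    apply: eq_exist; apply/funext => i /=.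
    exact: (reconstruction_quot_map t_drop hjs v w X_fixed X_cycle).
  rewrite -[RHS]hsubmxK; congr row_mx.
    rewrite -[RHS]vec_mxK; congr mxvec; apply/matrixP => a b; rewrite mxE /=.
    rewrite (reconstruction_start_row hjs).
    - by rewrite wE mxE qE.
    - by rewrite -S0_im codom_f.
    - by have := codom_f (T (c (S0 b))) a; rewrite T_im.
  rewrite -[RHS]vec_mxK; congr mxvec; apply/matrixP => a b; rewrite mxE /=.
  rewrite (reconstruction_start_col _ hjs).
    by rewrite vE mxE.
  by rewrite -S1_im codom_f.
- move=> P; rewrite /coordinates; congr pair.
    apply: eq_exist; apply/funext => i; apply/matrixP => a b.
    rewrite [LHS]mxE [RHS]mxE [quot_map _ _ _ _ _ a b]mxE !mul_diag_map.
    rewrite !mxE rmorphM; congr (_ * _); rewrite /diag_coef -(o_hom_str h).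
    by case: eqP; rewrite ?rmorph1.
  rewrite /= /affine_pmap map_row_mx !map_mxvec.
  by congr (row_mx (mxvec _) (mxvec _)); apply/matrixP => a b; rewrite !mxE.
Qed.

End CoordinateIsomorphism.

Theorem theorem4p4p7 (O : idomainType) (pi : O)
    (hO : complete_dvr_perfect pi)
    (m n r : nat) (hm : (0 < m)%N) (hr : (0 < r)%N) (hrn : (r < n)%N)
    (phi : 'I_m -> 'M[O]_n) (hphi : generalized_local_model pi phi)
    (t : 'I_m -> 'I_n -> bool) (ht : admissible pi r phi t) :
  let s := #|always0 t| in
  let t1 := #|always1 t| in
  forall (js : 'I_m -> 'I_(n - r - s) -> 'I_n) (hjs : enumeration t js),
    isomorphic (scheme_U r phi t)
      (product (scheme_W pi phi t js)
         (affine_space O (r * s + t1 * (n - r - s)))).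
Proof.
move=> s t1 js hjs; case: hO => _ unif _ _; case: ht => card_t _ t_pi.
have pi1 : pi <> 1.
  by case: unif => _ [_ pi1 _] e; apply: pi1; exists 1; rewrite // mulr1.
have [c phiE] := generalized_local_model_diag unif hphi; subst phi.
have t_drop i j : t i j -> ~~ t (ordS i) j -> i = c j.
  move=> ti tS; have /colP/(_ j) := t_pi i j ti tS.
  rewrite mul_diag_mx !mxE !eqxx !mulr1 /diag_coef.
  by case: eqP => // _ e; case: pi1.
have [S0 [S0_inj S0_im]] := enumerate (erefl #|always0 t|).
have [S1 [S1_inj S1_im]] := enumerate (erefl #|always1 t|).
have [T hT] := choice (fun i => enumerate (card_t i)).
apply: isomorphic_trans (isomorphic_sym (projectors_isomorphic _ card_t)) _.
apply: (coordinates_isomorphic pi1 t_drop hjs S0_inj S0_im S1_inj S1_im).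
  by move=> i; exact: (hT i).1.
by move=> i; exact: (hT i).2.
Qed.
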